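(* Let $\tilde\alpha=\hat Y^{-1}\hat\alpha^\circ$, let $\varepsilon>0$, let $C>0$ be a constant such that $\mathrm{dist}(\alpha,\mathcal F_e)\le C(g(\alpha))_+$ for all $\alpha\in\mathbb C^d$, let $\bar\beta=\eta^LL^p$, and let $\lambda>0$ satisfy $$\lambda\ \ge\ C\,\bar\beta^{\frac1p}\left(\varepsilon (L+1)^{\frac p2-1}\right)^{-\frac1p}\Phi(\tilde\alpha).$$ Then for any global minimizer $\alpha^*$ of $$\min_{\alpha\in\mathbb C^d}\ F_\lambda(\alpha):=\Phi(\alpha)+\lambda(g(\alpha))_+ ,$$ the projection $\alpha_\varepsilon:=\mathcal P_{\mathcal F_e}(\alpha^* )$ of $\alpha^*$ onto $\mathcal F_e$ is an $\varepsilon$-minimizer of $\min\{\Phi(\alpha):\alpha\in\mathcal F_e\}$, that is, $\alpha_\varepsilon\in\mathcal F_e$ and $\Phi(\alpha_\varepsilon)\le\min\{\Phi(\alpha):\alpha\in\mathcal F_e\}+\varepsilon$.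
   Context: Fix $0<p<1$ and $\eta>1$; put $\beta_0=1$ and $\beta_l=\eta^l l^p$ for $l\ge1$. $\mathbb S^2\subset\mathbb R^3$ is the unit sphere with surface measure $\sigma$, $\sigma(\mathbb S^2)=4\pi$; $Y_{l,m}$ ($l\ge0$, $-l\le m\le l$) are the complex spherical harmonics, an orthonormal basis of $L_2(\mathbb S^2)$. $\Gamma\subset\mathbb S^2$ is a measurable set containing a nonempty open subset of $\mathbb S^2$, with $\mathbb S^2\setminus\Gamma$ nonempty. $T^\circ\in L_2(\mathbb S^2)$ is real-valued, $c=\int_{\mathbb S^2}|T^\circ|^2d\sigma$, and $\varrho$ is a real number with $\int_{\mathbb S^2\setminus\Gamma}|T^\circ|^2d\sigma<\varrho<c$. Fix $L\in\mathbb N_0$, $d=(L+1)^2$. Vectors $\alpha\in\mathbb C^d$ are grouped as $\alpha=(\alpha_{0\cdot}^T,\dots,\alpha_{L\cdot}^T)^T$, $\alpha_{l\cdot}=(\alpha_{l,-l},\dots,\alpha_{l,l})^T\in\mathbb C^{2l+1}$; $\|\cdot\|$ is the $\ell_2$ norm. $\hat Y\in\mathbb C^{d\times d}$ has entry $\int_\Gamma\overline{Y_{l,m}}\,Y_{l',m'}\,d\sigma$ in row $(l,m)$, column $(l',m')$ (it is Hermitian positive definite), and $\hat\alpha^\circ\in\mathbb C^d$ has entries $\int_\Gamma T^\circ\,\overline{Y_{l,m}}\,d\sigma$. Define $\Phi(\alpha)=\sum_{l=0}^L\beta_l\|\alpha_{l\cdot}\|^p$, $g(\alpha)=\alpha^H\hat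 Y\alpha-2\mathrm{Re}(\alpha^H\hat\alpha^\circ)+c-\varrho$, $(t)_+=\max\{t,0\}$, $\mathcal F_e=\{\alpha\in\mathbb C^d:g(\alpha)\le0\}$ (closed, convex), and $\mathrm{dist}(\alpha,\mathcal F_e)=\inf_{z\in\mathcal F_e}\|\alpha-z\|$. Standing assumption: $L$ is such that $\mathcal F_e$ has nonempty interior. (Since $c>\varrho$, $0\notin\mathcal F_e$.) *)

(* Defs.v *)
(* MathComp / MathComp-Analysis; the complex numbers are [R[i]]. *)
From HB Require Import structures.
From mathcomp Require Import all_boot all_order all_algebra complex.
From mathcomp Require Import all_classical all_reals all_analysis measurable_realfun.
From mathcomp Require Import ring.

Set Implicit Arguments.
Unset Strict Implicit.
Unset Printing Implicit Defensive.

Import Order.TTheory GRing.Theory Num.Theory.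
Import numFieldNormedType.Exports.

Local Open Scope classical_set_scope.
Local Open Scope complex_scope.
Local Open Scope sesquilinear_scope.
Local Open Scope ring_scope.

Section Sphere.
Variable R : realType.

Definition sphere : set (R * R * R) :=
  [set x | x.1.1 ^+ 2 + x.1.2 ^+ 2 + x.2 ^+ 2 = 1].

(* The parametrization (z, phi) |-> (sqrt(1-z^2) cos phi, sqrt(1-z^2) sin phi, z)
   of the sphere, i.e. spherical coordinates with z = cos theta. Its area
   element |d_z x d_phi| is identically 1 (sin theta dtheta dphi = dz dphi). *)
Definition sphere_param (u : measurableTypeR R * measurableTypeR R) : R * R * R :=
  (Num.sqrt (1 - u.1 ^+ 2) * cos u.2, Num.sqrt (1 - u.1 ^+ 2) * sin u.2, u.1).

Definition param_domain : set (measurableTypeR R * measurableTypeR R) :=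
  [set` `[-1, 1]] `*` [set` `[0, 2 * pi]].

(* Surface measure, as a Borel measure on R^3 carried by the sphere. *)
Definition surface (A : set (R * R * R)) : \bar R :=
  (lebesgue_measure \x lebesgue_measure)%E
    (sphere_param @^-1` A `&` param_domain).

Lemma measurable_param_domain : measurable param_domain.
Proof. by apply: measurableX; exact: measurable_itv. Qed.

Lemma measurable_sphere_param : measurable_fun setT sphere_param.
Proof.
have m1 : measurable_fun setT
   (fun u : measurableTypeR R * measurableTypeR R => Num.sqrt (1 - u.1 ^+ 2) : R).
  apply: (@measurableT_comp _ _ _ _ _ _ (@Num.sqrt R)).
    by apply: continuous_measurable_fun; exact: sqrt_continuous.
  by apply: measurable_funB => //; apply: measurable_funX; exact: measurable_fst.
apply: measurable_fun_pair; last exact: measurable_fst.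
apply: measurable_fun_pair; apply: measurable_funM => //.
  apply: (@measurableT_comp _ _ _ _ _ _ (@cos R)); last exact: measurable_snd.
  by apply: continuous_measurable_fun; exact: continuous_cos.
apply: (@measurableT_comp _ _ _ _ _ _ (@sin R)); last exact: measurable_snd.
by apply: continuous_measurable_fun; exact: continuous_sin.
Qed.

Let surface0 : surface set0 = 0%E.
Proof. by rewrite /surface preimage_set0 set0I measure0. Qed.

Let surface_ge0 A : (0 <= surface A)%E.
Proof. exact: measure_ge0. Qed.

Let surface_sigma_additive : semi_sigma_additive surface.
Proof.
pose mu := mrestr (@lebesgue_measure R \x @lebesgue_measure R)%E
  measurable_param_domain.
have mP A : measurable A -> measurable (sphere_param @^-1` A).
  by move=> mA; rewrite -[X in measurable X]setTI; exact: measurable_sphere_param.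
move=> F mF tF mUF; rewrite /surface preimage_bigcup.
apply: (@measure_semi_sigma_additive _ _ _ mu) => [n||].
- exact: mP.
- apply/trivIsetP => i j _ _ ij; rewrite -preimage_setI.
  by move/trivIsetP : tF => /(_ _ _ Logic.I Logic.I ij) ->; rewrite preimage_set0.
- by rewrite -preimage_bigcup; exact: mP.
Qed.

HB.instance Definition _ := isMeasure.Build _ _ _ surface
  surface0 surface_ge0 surface_sigma_additive.

Lemma surface_sphere : surface sphere = (4 * pi)%:E.
Proof.
rewrite /surface (_ : _ `&` _ = param_domain); last first.
  apply/setIidPr => -[z t] /= [/= + _]; rewrite in_itv /= => /andP[z0 z1].
  rewrite /sphere /= !exprMn -mulrDr addrC cos2Dsin2 mulr1 sqr_sqrtr ?subrKC//.
  by rewrite subr_ge0 -real_normK ?num_real// expr_le1// ler_norml z0.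
rewrite product_measure1E//= !lebesgue_measure_itv/= !lte_fin.
rewrite mulr_gt0 ?pi_gt0// gtrN// -!EFinB -EFinM opprK subr0.
by rewrite mulrA -[1 + 1]/(2%:R) -natrM.
Qed.

(* The integral over D of the square of f; c is its value for D the sphere. *)
Definition energy (f : R * R * R -> R) (D : set (R * R * R)) : R :=
  \int[surface]_(x in D) (f x ^+ 2).

Definition L2_sphere (f : R * R * R -> R) : Prop :=
  measurable_fun sphere f /\
  surface.-integrable sphere (fun x => (f x ^+ 2)%:E).

(* The library's integral is real-valued: integrate componentwise. *)
Definition Cintegral (D : set (R * R * R)) (f : R * R * R -> R[i]) : R[i] :=
  (\int[surface]_(x in D) (complex.Re (f x))) +i*
  (\int[surface]_(x in D) (complex.Im (f x))).

(* The polynomial factor of the associated Legendre function: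
   P_l^m(t) = (-1)^m (1 - t^2)^(m/2) d^m/dt^m P_l(t), with Rodrigues' formula
   P_l = 1/(2^l l!) d^l/dt^l (t^2 - 1)^l. *)
Definition legendre_deriv (l m : nat) : {poly R} :=
  ((2 ^ l * l`!)%:R)^-1 *: (('X^2 - 1) ^+ l)^`(l + m).

(* sqrt((2l+1)/(4 pi) * (l-m)!/(l+m)!) *)
Definition sph_norm (l m : nat) : R :=
  Num.sqrt ((l.*2.+1)%:R / (4 * pi) * ((l - m)`!%:R / (l + m)`!%:R)).

(* Y_{l,m} = N_{l,m} P_l^m(cos theta) e^{i m phi} for 0 <= m <= l, in Cartesian
   coordinates: sin^m theta e^{i m phi} = (x + i y)^m and cos theta = z. *)
Definition sph_harm_nat (l m : nat) (x : R * R * R) : R[i] :=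
  ((-1) ^+ m * sph_norm l m * (legendre_deriv l m).[x.2])%:C
  * (x.1.1 +i* x.1.2) ^+ m.

(* Y_{l,-m} = (-1)^m conj(Y_{l,m}) *)
Definition sph_harm (l : nat) (m : int) (x : R * R * R) : R[i] :=
  match m with
  | Posz k => sph_harm_nat l k x
  | Negz k => (-1) ^+ k.+1 * (sph_harm_nat l k.+1 x)^*
  end.

End Sphere.
Arguments sphere : clear implicits.
Arguments surface : clear implicits.

Section Problem.
Variable R : realType.

(* d = (L+1)^2, presented as the sum over l <= L of the block sizes 2l+1, so that
   alpha_{l.} is a block of the library's block vectors; entry j of block l has order m = j - l. *)
Definition block_size (L : nat) (l : 'I_L.+1) : nat := (l.*2.+1)%N.

Definition dimL (L : nat) : nat := (\sum_(l < L.+1) block_size l)%N.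

Lemma dimLE L : dimL L = (L.+1 ^ 2)%N.
Proof.
rewrite /dimL /block_size; elim: L => [|L IH]; first by rewrite big_ord1.
by rewrite big_ord_recr /= IH -mul2n; ring.
Qed.

Definition coef_block (L : nat) (a : 'cV[R[i]]_(dimL L)) (l : 'I_L.+1) :
    'cV[R[i]]_(block_size l) :=
  @submxcol _ _ (@block_size L) 1 a l.

Definition order_of (L : nat) (l : 'I_L.+1) (j : 'I_(block_size l)) : int :=
  j%:Z - l%:Z.

Definition l2norm (n : nat) (v : 'cV[R[i]]_n) : R :=
  Num.sqrt (\sum_(i < n) ComplexField.Normc.normc (v i 0) ^+ 2).

Definition Yhat (Gamma : set (R * R * R)) (L : nat) : 'M[R[i]]_(dimL L) :=
  @mxblock _ _ _ (@block_size L) (@block_size L) (fun l l' =>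
    \matrix_(j < block_size l, j' < block_size l')
      Cintegral Gamma (fun x =>
        (sph_harm l (order_of j) x)^* * sph_harm l' (order_of j') x)).

Definition ahat (Gamma : set (R * R * R)) (T : R * R * R -> R) (L : nat) :
    'cV[R[i]]_(dimL L) :=
  @mxcol _ _ (@block_size L) 1 (fun l =>
    \col_(j < block_size l)
      Cintegral Gamma (fun x => (T x)%:C * (sph_harm l (order_of j) x)^*)).

Definition beta_weight (p eta : R) (l : nat) : R :=
  if l is 0%N then 1 else eta ^+ l * l%:R `^ p.

Definition Phi (p eta : R) (L : nat) (a : 'cV[R[i]]_(dimL L)) : R :=
  \sum_(l < L.+1) beta_weight p eta l * l2norm (coef_block a l) `^ p.
Arguments Phi p eta L a : clear implicits.

(* a^H Yhat a is real since Yhat is Hermitian, hence the first Re is harmless. *)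
Definition gfun (Gamma : set (R * R * R)) (T : R * R * R -> R) (rho : R)
    (L : nat) (a : 'cV[R[i]]_(dimL L)) : R :=
  complex.Re ((a^t* *m Yhat Gamma L *m a) 0 0)
  - 2 * complex.Re ((a^t* *m ahat Gamma T L) 0 0)
  + energy T (sphere R) - rho.
Arguments gfun Gamma T rho L a : clear implicits.

Definition pos_part (t : R) : R := Num.max t 0.

Definition Fe (Gamma : set (R * R * R)) (T : R * R * R -> R) (rho : R)
    (L : nat) : set 'cV[R[i]]_(dimL L) :=
  [set a | gfun Gamma T rho L a <= 0].

Definition Flambda (p eta : R) (Gamma : set (R * R * R)) (T : R * R * R -> R)
    (rho lambda : R) (L : nat) (a : 'cV[R[i]]_(dimL L)) : R :=
  Phi p eta L a + lambda * pos_part (gfun Gamma T rho L a).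

Definition alpha_tilde (Gamma : set (R * R * R)) (T : R * R * R -> R)
    (L : nat) : 'cV[R[i]]_(dimL L) :=
  invmx (Yhat Gamma L) *m ahat Gamma T L.

Section Vectors.
Variable n : nat.
Implicit Types (a z : 'cV[R[i]]_n) (S : set 'cV[R[i]]_n).

Definition has_nonempty_interior S : Prop :=
  exists z r, 0 < r /\ (forall a, l2norm (a - z) < r -> S a).

Definition dist_to a S : R := inf [set l2norm (a - z) | z in S].

Definition minimizer (f : 'cV[R[i]]_n -> R) S z : Prop :=
  S z /\ forall y, S y -> f z <= f y.

(* Metric projection: a nearest point of S; the default value 0 is only used
   when there is none, which never happens for S nonempty, closed and convex. *)
Definition metric_proj S a : 'cV[R[i]]_n :=
  xget 0 [set z | minimizer (fun y => l2norm (a - y)) S z].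

(* f z <= min_S f + eps, the minimum being a genuine (attained) one. *)
Definition eps_minimizer (eps : R) (f : 'cV[R[i]]_n -> R) S z : Prop :=
  S z /\ exists2 y, minimizer f S y & f z <= f y + eps.

End Vectors.
End Problem.
Arguments Phi {R} p eta L a.
Arguments gfun {R} Gamma T rho L a.
Arguments Fe {R} Gamma T rho L.
Arguments Flambda {R} p eta Gamma T rho lambda L a.

(* Main.v *)
(* Completing the square, g(a) = g(at) + q(a - at) with at the solution of Yhat at = ahat and
   q the quadratic form of Yhat, so at is feasible as soon as some point is. Comparing
   F_lambda at the minimizer astar with its value at at gives lambda g(astar)_+ <= Phi(at), and
   the error bound turns this into a bound on the distance from astar to its projection; the
   subadditivity of t^p and the power mean inequality over the L+1 blocks then bound the
   increase of Phi by eps.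

   Positive definiteness of Yhat: if q(a) = 0, the combination of spherical harmonics vanishes
   on an open rectangle of the coordinates (z, phi). It is a Laurent polynomial in e^{i phi},
   so each azimuthal order vanishes separately, and for a fixed order the derivatives of the
   Legendre polynomials have distinct degrees.

   For L = 0 the constant eta^L L^p is 0 and the lower bound on lambda is void; there Phi is
   |a|^p and the feasible set a disc, and every lambda > 0 works for geometric reasons. *)

Require Import Defs.
From mathcomp Require Import all_boot all_order all_algebra complex.
From mathcomp Require Import all_classical all_reals all_analysis.
From mathcomp Require Import measurable_realfun zify ring lra.

Set Implicit Arguments.
Unset Strict Implicit.
Unset Printing Implicit Defensive.

Import Order.TTheory GRing.Theory Num.Theory.
Import numFieldNormedType.Exports.

Local Open Scope classical_set_scope.
Local Open Scope ring_scope.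

(** * Inequalities and norms *)

Section RealInequalities.
Variable R : realType.
Implicit Types x y p q : R.

(** With [s = x + y], a share [z / s] in [0, 1] is at most its [p]-th power because [p <= 1].
    Multiplying by [s ^ p] and adding the shares of [x] and [y] gives the claim. *)
Lemma powRD_le x y p : 0 <= x -> 0 <= y -> 0 < p -> p <= 1 ->
  (x + y) `^ p <= x `^ p + y `^ p.
Proof.
move=> x0 y0 p0 p1; have [xy0|xyN0] := eqVneq (x + y) 0.
  by rewrite xy0 powR0 ?gt_eqF// addr_ge0// powR_ge0.
have xy_gt0 : 0 < x + y by rewrite lt_neqAle eq_sym xyN0 addr_ge0.
have share z : 0 <= z -> z <= x + y -> z / (x + y) * (x + y) `^ p <= z `^ p.
  rewrite le_eqVlt => /predU1P[<-|z0] zxy; first by rewrite !mul0r powR_ge0.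
  rewrite -[in leRHS](divfK xyN0 z) powRM ?divr_ge0 ?(ltW z0) ?(ltW xy_gt0)//.
  rewrite ler_wpM2r ?powR_ge0// ger1_powR// divr_gt0//=.
  by rewrite ler_pdivrMr// mul1r.
apply: le_trans (lerD (share x _ _) (share y _ _)); rewrite ?lerDl ?lerDr//.
by rewrite -mulrDl -mulrDl divff// mul1r.
Qed.

(** Young's inequality for the product of [x ^ q] and 1, with conjugate exponents [1 / q] and
    [1 / (1 - q)]. *)
Lemma powR_bernoulli x q : 0 <= x -> 0 < q -> q < 1 ->
  x `^ q <= q * x + (1 - q).
Proof.
move=> x0 q0 q1; have q'0 : 0 < 1 - q by lra.
have := @conjugate_powR _ (x `^ q) 1 q^-1 (1 - q)^-1 (powR_ge0 _ _) ler01.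
rewrite !invr_gt0 !invrK subrKC mulr1 powR1 mul1r -powRrM mulfV ?gt_eqF// powRr1//.
by rewrite mulrC; apply.
Qed.

(** Power mean inequality: the concave function [t ^ q] lies below its tangent at the mean [S / n],
    and the tangent bounds add up to [n] times the value at the mean. *)
Lemma sum_powR_le (n : nat) (F : 'I_n -> R) q : (0 < n)%N ->
  (forall i, 0 <= F i) -> 0 < q -> q < 1 ->
  \sum_i F i `^ q <= n%:R `^ (1 - q) * (\sum_i F i) `^ q.
Proof.
move=> n0 F0 q0 q1; set S := \sum_i F i.
have S0 : 0 <= S by exact: sumr_ge0.
have nR0 : 0 < n%:R :> R by rewrite ltr0n.
have [SE|SN0] := eqVneq S 0.
  rewrite big1 ?mulr_ge0 ?powR_ge0// => i _.
  have /psumr_eq0P : S = 0 by [].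
  by move=> ->//; rewrite powR0 ?gt_eqF.
have Sgt0 : 0 < S by rewrite lt_neqAle eq_sym SN0.
have mgt0 : 0 < S / n%:R by rewrite divr_gt0.
(* Bernoulli's inequality applied to the ratio of [F i] to the mean. *)
have step i : F i `^ q <= (S / n%:R) `^ q * (q * (F i / (S / n%:R)) + (1 - q)).
  rewrite -[in leLHS](divfK (lt0r_neq0 mgt0) (F i)).
  rewrite [leLHS]powRM ?divr_ge0 ?(ltW mgt0)//.
  rewrite [leLHS]mulrC ler_wpM2l ?powR_ge0// powR_bernoulli//.
  by rewrite divr_ge0// ltW.
apply: le_trans (ler_sum _ (fun i _ => step i)) _.
rewrite -mulr_sumr big_split/= -mulr_sumr -mulr_suml -/S sumr_const card_ord.
rewrite -[(1 - q) *+ n]mulr_natr.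
have -> : q * (S / (S / n%:R)) + (1 - q) * n%:R = n%:R.
  by field; rewrite SN0 lt0r_neq0.
rewrite powRM ?invr_ge0 ?(ltW nR0)// -powR_inv1 ?(ltW nR0)// -powRrM mulN1r.
rewrite powRD; last by rewrite lt0r_neq0 ?implybT.
by rewrite powRr1 ?(ltW nR0)// le_eqVlt; apply/orP; left; apply/eqP; ring.
Qed.

(** Cauchy-Schwarz: for [A > 0] the sum of the squares of [A * y i - B * x i] equals
    [A * (A * D - B ^ 2)], which is therefore nonnegative. *)
Lemma sum_mul_sqr_le (I : finType) (x y : I -> R) :
  (\sum_i x i * y i) ^+ 2 <= (\sum_i x i ^+ 2) * (\sum_i y i ^+ 2).
Proof.
set A := \sum_i x i ^+ 2; set B := \sum_i x i * y i; set D := \sum_i y i ^+ 2.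
have A0 : 0 <= A by apply: sumr_ge0 => i _; exact: sqr_ge0.
have [AE|AN0] := eqVneq A 0.
  rewrite AE mul0r /B big1 ?expr0n// => i _.
  have /psumr_eq0P : A = 0 by [].
  move=> /(_ (fun i _ => sqr_ge0 _) i erefl) /eqP; rewrite sqrf_eq0 => /eqP ->.
  by rewrite mul0r.
have Agt0 : 0 < A by rewrite lt_neqAle eq_sym AN0.
have E : \sum_i (A * y i - B * x i) ^+ 2 = A * (A * D - B ^+ 2).
  transitivity (\sum_i (A ^+ 2 * y i ^+ 2
      - (A * B *+ 2) * (x i * y i) + B ^+ 2 * x i ^+ 2)).
    by apply: eq_bigr => i _; ring.
  by rewrite big_split/= sumrB -!mulr_sumr -/A -/B -/D; ring.
have : 0 <= A * (A * D - B ^+ 2).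
  by rewrite -E; apply: sumr_ge0 => i _; exact: sqr_ge0.
by rewrite pmulr_rge0// subr_ge0.
Qed.

End RealInequalities.

(** * The Euclidean norm on complex column vectors *)

Section L2norm.
Variable R : realType.
Import ComplexField.Normc.
Local Open Scope complex_scope.

Lemma normc_sqr (z : R[i]) : normc z ^+ 2 = complex.Re z ^+ 2 + complex.Im z ^+ 2.
Proof. by case: z => a b; rewrite /= sqr_sqrtr// addr_ge0 ?sqr_ge0. Qed.

Lemma l2norm_ge0 n (v : 'cV[R[i]]_n) : 0 <= l2norm v.
Proof. exact: sqrtr_ge0. Qed.

Lemma l2norm_sqr n (v : 'cV[R[i]]_n) :
  l2norm v ^+ 2 = \sum_i normc (v i 0) ^+ 2.
Proof. by rewrite sqr_sqrtr//; apply: sumr_ge0 => i _; exact: sqr_ge0. Qed.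

Lemma l2norm0 n : l2norm (0 : 'cV[R[i]]_n) = 0.
Proof.
by rewrite /l2norm big1 ?sqrtr0// => i _; rewrite mxE normc0 expr0n.
Qed.

Lemma l2norm_eq0 n (v : 'cV[R[i]]_n) : l2norm v = 0 -> v = 0.
Proof.
move=> v0; have := l2norm_sqr v; rewrite v0 expr0n/= => /esym/psumr_eq0P h.
apply/matrixP => i j; rewrite ord1 mxE; apply: eq0_normc; apply/eqP.
by rewrite -sqrf_eq0 h// => k _; exact: sqr_ge0.
Qed.

Lemma l2normN n (v : 'cV[R[i]]_n) : l2norm (- v) = l2norm v.
Proof. by congr Num.sqrt; apply: eq_bigr => i _; rewrite mxE normcN. Qed.

Lemma l2normZ n (t : R) (v : 'cV[R[i]]_n) :
  0 <= t -> l2norm (t%:C *: v) = t * l2norm v.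
Proof.
move=> t0; rewrite /l2norm.
have -> : \sum_i normc ((t%:C *: v) i 0) ^+ 2 = t ^+ 2 * \sum_i normc (v i 0) ^+ 2.
  rewrite mulr_sumr; apply: eq_bigr => i _.
  by rewrite mxE normcM exprMn /= expr0n addr0 sqr_sqrtr// sqr_ge0.
by rewrite sqrtrM ?sqr_ge0// sqrtr_sqr ger0_norm.
Qed.

Lemma l2norm_normc_le n (v : 'cV[R[i]]_n) i : normc (v i 0) <= l2norm v.
Proof.
have nv0 : 0 <= normc (v i 0) by case: (v i 0) => a b; exact: sqrtr_ge0.
rewrite -(@ler_pXn2r _ 2)// ?nnegrE ?l2norm_ge0//.
rewrite l2norm_sqr (bigD1 i)//= lerDl; apply: sumr_ge0 => j _; exact: sqr_ge0.
Qed.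

Lemma l2normD n (u v : 'cV[R[i]]_n) : l2norm (u + v) <= l2norm u + l2norm v.
Proof.
have n0 (z : R[i]) : 0 <= normc z by case: z => a b; exact: sqrtr_ge0.
rewrite -(@ler_pXn2r _ 2)// ?nnegrE ?addr_ge0 ?l2norm_ge0//.
rewrite [leRHS]sqrrD !l2norm_sqr.
have cs : \sum_i normc (u i 0) * normc (v i 0) <= l2norm u * l2norm v.
  rewrite -(@ler_pXn2r _ 2)// ?nnegrE ?mulr_ge0 ?l2norm_ge0//; last first.
    by apply: sumr_ge0 => i _; exact: mulr_ge0.
  by rewrite exprMn !l2norm_sqr; exact: sum_mul_sqr_le.
apply: (@le_trans _ _ (\sum_i (normc (u i 0) + normc (v i 0)) ^+ 2)).
  apply: ler_sum => i _; rewrite mxE ler_pXn2r ?nnegrE ?addr_ge0//.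
  exact: le_normcD.
under eq_bigr do rewrite sqrrD.
by rewrite !big_split/= lerD2r lerD2l mulr2n lerD.
Qed.

Lemma l2normB n (u v : 'cV[R[i]]_n) : l2norm (u - v) = l2norm (v - u).
Proof. by rewrite -opprB l2normN. Qed.

(** Flat indices correspond bijectively to pairs of a block and a position in it, through
    [tagnat.sig]; the double sum is reindexed along this bijection. *)
Lemma l2norm_coef_block L (a : 'cV[R[i]]_(dimL L)) :
  \sum_l l2norm (coef_block a l) ^+ 2 = l2norm a ^+ 2.
Proof.
rewrite l2norm_sqr; under eq_bigr do rewrite l2norm_sqr.
rewrite sig_big_dep/= (reindex (@tagnat.sig _ (@block_size L)))/=; last first.
  exact: tagnat.sig_bij_on.
apply: eq_bigr => s _; rewrite mxE; congr (normc (a _ _) ^+ 2).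
by rewrite -[RHS]tagnat.sigK /tagnat.Rank; case: (tagnat.sig s).
Qed.

End L2norm.

(** * Existence of minimizers *)

(* Continuity on one side, boundedness and measurability on the other, are
   transferred from the real and imaginary parts to complex polynomial
   expressions by the same argument, hence the abstract predicate [P]. *)
Section ComponentwiseClosure.
Variables (R : realType) (T : Type) (P : (T -> R) -> Prop).
Local Open Scope complex_scope.

Definition subalgebra_of_functions : Prop :=
  [/\ forall c, P (fun=> c),
      forall f g, P f -> P g -> P (fun x => f x + g x)
    & forall f g, P f -> P g -> P (fun x => f x * g x)].

Definition componentwise (f : T -> R[i]) : Prop :=
  P (fun x => complex.Re (f x)) /\ P (fun x => complex.Im (f x)).

Hypothesis Palg : subalgebra_of_functions.

Lemma subalgebra_cst c : P (fun=> c). Proof. by case: Palg. Qed.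

Lemma subalgebraD f g : P f -> P g -> P (fun x => f x + g x).
Proof. by case: Palg => _ h _; exact: h. Qed.

Lemma subalgebraM f g : P f -> P g -> P (fun x => f x * g x).
Proof. by case: Palg => _ _; apply. Qed.

Lemma subalgebraN f : P f -> P (fun x => - f x).
Proof.
move=> Pf; have := subalgebraM (subalgebra_cst (-1)) Pf.
by congr (P _); apply/funext => x; rewrite mulN1r.
Qed.

Lemma subalgebra_sum (I : Type) (r : seq I) (Q : pred I) (F : I -> T -> R) :
  (forall i, P (F i)) -> P (fun x => \sum_(i <- r | Q i) F i x).
Proof.
move=> PF; elim: r => [|i r IH].
  by under eq_fun do rewrite big_nil; exact: subalgebra_cst.
under eq_fun do rewrite big_cons.
by case: (Q i) => //; exact: subalgebraD.
Qed.

Lemma componentwise_Re f g :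
  componentwise f -> (forall x, complex.Re (f x) = g x) -> P g.
Proof. by move=> [+ _] /funext <-. Qed.

Lemma componentwise_cst c : componentwise (fun=> c).
Proof. by split; exact: subalgebra_cst. Qed.

Lemma componentwiseD f g :
  componentwise f -> componentwise g -> componentwise (fun x => f x + g x).
Proof.
move=> [rf If] [rg Ig]; split.
  have := subalgebraD rf rg.
  by congr (P _); apply/funext => x; case: (f x) (g x) => ? ? [].
have := subalgebraD If Ig.
by congr (P _); apply/funext => x; case: (f x) (g x) => ? ? [].
Qed.

Lemma componentwiseM f g :
  componentwise f -> componentwise g -> componentwise (fun x => f x * g x).
Proof.
move=> [rf If] [rg Ig]; split.
  have := subalgebraD (subalgebraM rf rg) (subalgebraN (subalgebraM If Ig)).
  by congr (P _); apply/funext => x; case: (f x) (g x) => ? ? [].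
have := subalgebraD (subalgebraM rf Ig) (subalgebraM If rg).
by congr (P _); apply/funext => x; case: (f x) (g x) => ? ? [].
Qed.

Lemma componentwise_conj f :
  componentwise f -> componentwise (fun x => Num.conj (f x)).
Proof.
move=> [rf If]; split.
  by move: rf; congr (P _); apply/funext => x; case: (f x).
by have := subalgebraN If; congr (P _); apply/funext => x; case: (f x).
Qed.

Lemma Re_sum (I : Type) (r : seq I) (Q : pred I) (F : I -> R[i]) :
  complex.Re (\sum_(i <- r | Q i) F i) = \sum_(i <- r | Q i) complex.Re (F i).
Proof. exact: (raddf_sum (@complex.Re R : Rcomplex R -> R)). Qed.

Lemma Im_sum (I : Type) (r : seq I) (Q : pred I) (F : I -> R[i]) :
  complex.Im (\sum_(i <- r | Q i) F i) = \sum_(i <- r | Q i) complex.Im (F i).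
Proof. exact: (raddf_sum (@complex.Im R : Rcomplex R -> R)). Qed.

Lemma componentwise_sum (I : Type) (r : seq I) (Q : pred I) (F : I -> T -> R[i]) :
  (forall i, componentwise (F i)) ->
  componentwise (fun x => \sum_(i <- r | Q i) F i x).
Proof.
move=> PF; split.
  by under eq_fun do rewrite Re_sum; apply: subalgebra_sum => i; case: (PF i).
by under eq_fun do rewrite Im_sum; apply: subalgebra_sum => i; case: (PF i).
Qed.

Lemma componentwiseX f n : componentwise f -> componentwise (fun x => f x ^+ n).
Proof.
move=> Pf; elim: n => [|n IH].
  by under eq_fun do rewrite expr0; exact: componentwise_cst.
by under eq_fun do rewrite exprS; exact: componentwiseM.
Qed.

End ComponentwiseClosure.

(** * Attainment of minima in real coordinates *)

Section Minimization.
Variable R : realType.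
Import ComplexField.Normc.
Local Open Scope complex_scope.

Lemma continuous_subalgebra (T : topologicalType) :
  subalgebra_of_functions (fun f : T -> R => continuous f).
Proof.
split=> [c x|f g cf cg x|f g cf cg x]; first exact: cvg_cst.
  by apply: cvgD; [exact: cf|exact: cg].
by apply: cvgM; [exact: cf|exact: cg].
Qed.

(** Subadditivity makes [t ^ p] Hölder continuous of exponent [p] on the half-line, 0 included;
    hence the modulus [e ^ (1 / p)]. *)
Lemma continuous_powR_comp (T : topologicalType) (h : T -> R) p :
  0 < p -> p <= 1 -> (forall x, 0 <= h x) -> continuous h ->
  continuous (fun x => h x `^ p).
Proof.
move=> p0 p1 h0 ch x; apply/cvgrPdist_lt => e e0.
have d0 : 0 < e `^ p^-1 by exact: powR_gt0.
have holder u v : 0 <= u -> 0 <= v -> u `^ p - v `^ p <= `|u - v| `^ p.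
  move=> u0 v0; rewrite lerBlDr (le_trans _ (powRD_le _ _ p0 p1))//.
  apply: ge0_ler_powR; rewrite ?nnegrE ?addr_ge0 ?(ltW p0)//.
  by rewrite -lerBlDr ler_norm.
move/cvgrPdist_lt: (ch x) => /(_ _ d0); apply: filterS => y hxy.
apply: (@le_lt_trans _ _ (`|h x - h y| `^ p)).
  by rewrite ler_norml lerNl opprB holder// distrC holder.
rewrite -[e in ltRHS](powRr1 (ltW e0)) -(mulVf (lt0r_neq0 p0)) powRrM.
by apply: gt0_ltr_powR; rewrite ?nnegrE ?powR_ge0.
Qed.

(** Topological arguments on complex vectors take place in these real coordinates, real parts first
    and imaginary parts second. *)
Definition complex_coords n (x : 'rV[R]_(n + n)) : 'cV[R[i]]_n :=
  \col_i (x 0 (lshift n i) +i* x 0 (rshift n i)).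

Lemma complex_coords_surj n (v : 'cV[R[i]]_n) : exists x, complex_coords x = v.
Proof.
exists (row_mx (\row_i complex.Re (v i 0)) (\row_i complex.Im (v i 0))).
apply/matrixP => i j; rewrite ord1 mxE row_mxEl row_mxEr !mxE.
by case: (v i 0).
Qed.

Lemma complex_coords_continuous n i :
  componentwise (fun f : 'rV[R]_(n + n) -> R => continuous f)
    (fun x => complex_coords x i 0).
Proof.
by split; under eq_fun do rewrite mxE; exact: coord_continuous.
Qed.

Lemma l2norm_continuous n (T : topologicalType) (f : T -> 'cV[R[i]]_n) :
  (forall i, componentwise (fun f : T -> R => continuous f) (fun x => f x i 0)) ->
  continuous (fun x => l2norm (f x)).
Proof.
move=> cf x; apply: continuous_comp; last exact: sqrt_continuous.
suff : continuous (fun x => \sum_i normc (f x i 0) ^+ 2) by exact.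
have alg := continuous_subalgebra T.
apply: (subalgebra_sum alg) => i; under eq_fun do rewrite normc_sqr !expr2.
have [cr ci] := cf i.
by apply: (subalgebraD alg); exact: (subalgebraM alg).
Qed.

(** Weierstrass: cutting [S] down to the sublevel set of [f] through one of its points leaves a
    closed set, bounded by coercivity, hence compact; its minimum is also the minimum over [S]. *)
Lemma exists_minimizer n (f : 'cV[R[i]]_n -> R) (S : set 'cV[R[i]]_n) :
  continuous (fun x => f (complex_coords x)) ->
  closed (complex_coords (n:=n) @^-1` S) -> S !=set0 ->
  (forall M, exists B, forall v, f v <= M -> l2norm v <= B) ->
  exists z, minimizer f S z.
Proof.
move=> cf clS [z0 Sz0] coercive.
pose K := complex_coords (n:=n) @^-1` S `&` [set x | f (complex_coords x) <= f z0].
have [B fB] := coercive (f z0).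
have clK : closed K.
  apply: closedI => //.
  apply: (@preimage_closed _ _ (fun x => f (complex_coords x)) [set t | t <= f z0]).
    by move=> x _; exact: cf.
  exact: closed_le.
have cK : compact K.
  apply: bounded_closed_compact => //.
  exists B; split; first exact: num_real.
  move=> b Bb x [_ /= /fB xB]; apply: (le_trans _ (ltW Bb)).
  have B0 : 0 <= B by exact: le_trans (l2norm_ge0 _) xB.
  rewrite [leLHS]/Num.norm/= mx_normrE; apply/bigmax_leP; split=> // -[i j] _ /=.
  rewrite ord1; have comp k : `|x 0 (lshift n k)| <= B /\ `|x 0 (rshift n k)| <= B.
    have := le_trans (l2norm_normc_le (complex_coords x) k) xB.
    rewrite -(@ler_pXn2r _ 2)// ?nnegrE ?sqrtr_ge0//; last first.
      by rewrite mxE /= sqrtr_ge0.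
    rewrite normc_sqr mxE/= => le_B.
    by split; rewrite -(@ler_pXn2r _ 2)// ?nnegrE// real_normK ?num_real//;
      apply: le_trans le_B; rewrite ?lerDl ?lerDr sqr_ge0.
  by case: (split_ordP j) => k ->; case: (comp k).
have [x0 x0z0] := complex_coords_surj z0.
have K0 : K !=set0 by exists x0; split; rewrite /= x0z0.
have [c] := compact_EVT_min K0 cK (continuous_subspaceT cf).
rewrite inE => -[Sc cz0] cmin; exists (complex_coords c); split=> // y Sy.
have [yz0|/ltW z0y] := leP (f y) (f z0); last exact: le_trans z0y.
have [xy xyE] := complex_coords_surj y.
by rewrite -xyE; apply: cmin; rewrite inE; split; rewrite /= xyE.
Qed.

End Minimization.

(** * Linear independence of the spherical harmonics *)

Section Polynomials.

(** A nonzero polynomial has fewer distinct roots than its size, so it cannot vanish at the first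
    [size q] values of [f]. *)
Lemma poly_eq0_of_roots (F : idomainType) (q : {poly F}) (f : nat -> F) :
  injective f -> (forall n, q.[f n] = 0) -> q = 0.
Proof.
move=> injf qf; apply/eqP; apply: contraT => /max_poly_roots.
move=> /(_ (mkseq f (size q))); rewrite size_mkseq ltnn; apply.
  by apply/allP => _ /mapP[n _ ->]; rewrite rootE qf.
by rewrite mkseq_uniq.
Qed.

(** Among the polynomials with nonzero coefficient, the one of largest size contributes a top
    coefficient that no other term can cancel. *)
Lemma polys_distinct_size_free (F : idomainType) (I : finType) (Q : pred I)
    (q : I -> {poly F}) (a : I -> F) :
  (forall i, Q i -> q i != 0) ->
  {in Q &, injective (fun i => size (q i))} ->
  \sum_(i | Q i) a i *: q i = 0 -> forall i, Q i -> a i = 0.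
Proof.
move=> q0 qinj sum0 i0 Qi0; apply/eqP; apply: contraT => ai0.
pose P i := Q i && (a i != 0).
have Pi0 : P i0 by rewrite /P Qi0.
case: (arg_maxnP (fun i => size (q i)) Pi0) => i /andP[Qi ai] imax.
have /(congr1 (fun r : {poly F} => r`_(size (q i)).-1)) := sum0.
rewrite coef_sum coef0 (bigD1 i)//= big1 ?addr0 => [|j /andP[Qj ji]]; last first.
  rewrite coefZ; have [->|aj] := eqVneq (a j) 0; first by rewrite mul0r.
  rewrite nth_default ?mulr0// -ltnS prednK ?size_poly_gt0 ?q0//.
  rewrite ltn_neqAle [(_ <= _)%N]imax ?/P ?Qj// andbT.
  by apply: contraNneq ji => /qinj ->.
rewrite coefZ => /eqP; rewrite mulf_eq0 (negbTE ai) -/(lead_coef _) lead_coef_eq0.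
by rewrite (negbTE (q0 _ Qi)).
Qed.

(** Supplies infinitely many distinct roots inside an open interval; the shift to [n.+2] keeps the
    term of index 0 strictly below [b]. *)
Definition seq_between (R : realType) (a b : R) (n : nat) : R := a + (b - a) / n.+2%:R.

Lemma seq_between_itv (R : realType) (a b : R) n :
  a < b -> a < seq_between a b n < b.
Proof.
move=> ab; rewrite /seq_between; have ba : 0 < b - a by rewrite subr_gt0.
rewrite ltrDl divr_gt0//=.
rewrite -ltrBrDl ltr_pdivrMr// ltr_pMr// -[1]/(1%:R) ltr_nat//.
Qed.

Lemma seq_between_inj (R : realType) (a b : R) : a < b -> injective (seq_between a b).
Proof.
move=> ab m n /addrI/(mulfI _)-/(_ (negbT (gt_eqF _))).
rewrite subr_gt0 => /(_ ab) /invr_inj/eqP; rewrite eqr_nat => /eqP.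
by case.
Qed.

End Polynomials.

(** * Spherical harmonics in the coordinates (z, phi) *)

Section SphericalHarmonics.
Variable R : realType.
Local Open Scope complex_scope.

(** The monic polynomial [('X^2 - 1) ^+ l] has degree [2l], and [l + m] derivations in
    characteristic 0 lower it by exactly [l + m]. *)
Lemma size_legendre_deriv l m : (m <= l)%N ->
  size (legendre_deriv R l m) = (l - m).+1.
Proof.
move=> ml; rewrite /legendre_deriv size_scale; last first.
  by rewrite invr_eq0 pnatr_eq0 -lt0n muln_gt0 expn_gt0 fact_gt0.
rewrite cauchyreals.size_derivn.
have mon : ('X^2 - 1 : {poly R}) \is monic by rewrite -polyC1 monicXnsubC.
have : (('X^2 - 1 : {poly R}) ^+ l) != 0 by rewrite monic_neq0// monic_exp.
rewrite -size_poly_gt0 => /prednK <-; rewrite size_exp -polyC1 size_XnsubC//=.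
by rewrite mul2n -addnn subSn ?leq_add2l// subnDl.
Qed.

Lemma sph_norm_neq0 l m : sph_norm R l m != 0.
Proof.
rewrite gt_eqF// sqrtr_gt0 mulr_gt0// divr_gt0 ?ltr0n ?fact_gt0//.
by rewrite mulr_gt0// pi_gt0.
Qed.

Definition expi (phi : R) : R[i] := cos phi +i* sin phi.

Lemma expi_mul_conj phi : expi phi * Num.conj (expi phi) = 1.
Proof.
apply/eqP; rewrite eq_complex; apply/andP; split; rewrite /=; apply/eqP.
  by rewrite -(cos2Dsin2 phi); ring.
by ring.
Qed.

(** The subtraction formula makes the sine of the difference vanish, while sine is positive strictly
    between 0 and [pi]. *)
Lemma expi_inj phi psi : `|phi - psi| < pi -> expi phi = expi psi -> phi = psi.
Proof.
move=> lt_pi [ec es]; have s0 : sin `|phi - psi| = 0.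
  have s0 : sin (phi - psi) = 0 by rewrite sinB ec es; ring.
  have [d0|d0] := leP 0 (phi - psi); first by rewrite ger0_norm.
  by rewrite ltr0_norm// sinN s0 oppr0.
apply/eqP; rewrite -subr_eq0 -normr_eq0; apply: contraT => nz.
have := sin_gt0_pi (x := `|phi - psi|); rewrite s0 ltxx lt_pi andbT => -> //.
by rewrite lt_neqAle eq_sym nz normr_ge0.
Qed.

(** Constant in front of the Legendre factor. [Negz k] is the order [-(k+1)], for which the sign of
    the conjugation rule cancels the one in [sph_harm_nat]. *)
Definition sph_coef (l : nat) (m : int) : R :=
  match m with
  | Posz k => (-1) ^+ k * sph_norm R l k
  | Negz k => sph_norm R l k.+1
  end.

Lemma sph_coef_neq0 l m : sph_coef l m != 0.
Proof.
by case: m => k; rewrite /= ?mulf_neq0 ?sph_norm_neq0// expf_neq0// oppr_eq0 oner_eq0.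
Qed.

(* Multiplying by [e^{i L phi}] turns Laurent monomials of degree at least [-L]
   into monomials. *)
Lemma sph_harm_param l m (L : nat) z phi : (`|m| <= L)%N ->
  expi phi ^+ L * sph_harm l m (sphere_param (z, phi)) =
  (sph_coef l m * (legendre_deriv R l `|m|).[z]
    * Num.sqrt (1 - z ^+ 2) ^+ `|m|)%:C * expi phi ^+ `|(L%:Z + m)%R|.
Proof.
set s := Num.sqrt _.
have xy : (s * cos phi) +i* (s * sin phi) = s%:C * expi phi.
  by apply/eqP; rewrite eq_complex; apply/andP; split; rewrite /=; apply/eqP; ring.
case: m => k /= kL.
  rewrite /sph_harm_nat /= -/s xy exprMn exprD -!rmorphXn/= !rmorphM/=.
  by ring.
rewrite /sph_harm_nat -/s /= xy NegzE.
have -> : `|(L%:Z - k.+1%:Z)%R|%N = (L - k.+1)%N by rewrite subzn.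
(* Of the [L] factors [e], [k.+1] are spent on the conjugate powers in the harmonic of negative
   order. *)
rewrite -[in LHS](subnK kL) exprD; set e := expi phi; set P := _.[z].
have cR (x : R) : Num.conj x%:C = x%:C by apply/eqP; rewrite eq_complex /= oppr0 !eqxx.
have cM (u v : R[i]) : Num.conj (u * v) = Num.conj u * Num.conj v by exact: rmorphM.
have cX (u : R[i]) n : Num.conj (u ^+ n) = Num.conj u ^+ n by exact: rmorphXn.
rewrite cM cX cM !cR exprMn -mulrA.
have -> : e ^+ k.+1 * ((-1) ^+ k.+1 *
     (((-1) ^+ k.+1 * sph_norm R l k.+1 * P)%:C
      * (s%:C ^+ k.+1 * Num.conj e ^+ k.+1)))
   = ((-1) ^+ k.+1)%:C ^+ 2 * (sph_norm R l k.+1 * P * s ^+ k.+1)%:C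
     * (e * Num.conj e) ^+ k.+1.
  rewrite exprMn !rmorphM/= !rmorphXn/= rmorphN rmorph1; ring.
rewrite expi_mul_conj expr1n -rmorphXn/= sqrr_sign rmorph1.
by ring.
Qed.

Section Degrees.
Variable L : nat.
Implicit Type s : 'I_(dimL L).

Definition degree_of s : 'I_L.+1 := @tagnat.sig1 _ (@block_size L) s.

Definition azimuth_of s : int := order_of (@tagnat.sig2 _ (@block_size L) s).

Definition harmonic s (x : R * R * R) : R[i] := sph_harm (degree_of s) (azimuth_of s) x.

Lemma absz_azimuth_le s : (`|azimuth_of s| <= degree_of s)%N.
Proof.
rewrite /azimuth_of /order_of /degree_of.
case: (tagnat.sig2 s) => j /=; rewrite /block_size => jl.
by lia.
Qed.

Lemma degree_azimuth_inj s t :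
  degree_of s = degree_of t -> azimuth_of s = azimuth_of t -> s = t.
Proof.
rewrite /azimuth_of /order_of /degree_of => dst ast; apply: val_inj.
rewrite [LHS]tagnat.rect [RHS]tagnat.rect; congr (_ + _)%N; first by rewrite dst.
by move: ast (congr1 val dst) => /=; lia.
Qed.

Lemma harmonics_free (a : 'cV[R[i]]_(dimL L)) (z0 z1 phi0 phi1 : R) :
  (forall z : R, z0 < z < z1 -> -1 < z < 1) -> z0 < z1 -> phi0 < phi1 ->
  (forall z phi : R, z0 < z < z1 -> phi0 < phi < phi1 ->
    \sum_s a s 0 * harmonic s (sphere_param (z, phi)) = 0) ->
  a = 0.
Proof.
move=> z_itv z01 phi01 sum0; apply/matrixP => s0 j; rewrite ord1 mxE.
pose ex s := `|(L%:Z + azimuth_of s)%R|%N.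
pose A z s := sph_coef (degree_of s) (azimuth_of s)
  * (legendre_deriv R (degree_of s) `|azimuth_of s|).[z].
pose sg (z : R) : R := Num.sqrt (1 - z ^+ 2).
have azL s : (`|azimuth_of s| <= L)%N.
  by rewrite (leq_trans (absz_azimuth_le s))// -ltnS ltn_ord.
have exE s t : (ex s == ex t) = (azimuth_of s == azimuth_of t).
  by rewrite /ex; have := azL s; have := azL t; lia.
have A0 (z : R) : z0 < z < z1 ->
    \sum_(s | azimuth_of s == azimuth_of s0) a s 0 * (A z s)%:C = 0.
  move=> zz; have sg0 : sg z != 0.
    rewrite gt_eqF// sqrtr_gt0 subr_gt0 -real_normK ?num_real//.
    by rewrite expr_lt1// ltr_norml z_itv.
  (* Capping the length at 1, below [pi], keeps the values of [expi] at the sample points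
     distinct. *)
  pose phi2 : R := phi0 + Num.min (phi1 - phi0) 1.
  have phi02 : phi0 < phi2 by rewrite ltrDl lt_min subr_gt0 phi01 ltr01.
  (* For fixed [z], the vanishing sum times [expi phi ^+ L] is this polynomial evaluated at
     [expi phi]. *)
  pose Q := \sum_s (a s 0 * (A z s * sg z ^+ `|azimuth_of s|)%:C) *: 'X^(ex s).
  have Q0 : Q = 0.
    apply: (@poly_eq0_of_roots _ _ (fun n => expi (seq_between phi0 phi2 n))).
      move=> m n /expi_inj mn; apply: (seq_between_inj phi02); apply: mn.
      have := seq_between_itv m phi02; have := seq_between_itv n phi02.
      have : phi2 <= phi0 + 1 by rewrite lerD2l ge_min lexx orbT.
      have := pi_ge2 R; rewrite ltr_norml; lra.
    move=> n; set phi := seq_between _ _ _.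
    have phiI : phi0 < phi < phi1.
      have /andP[-> ltphi2] := seq_between_itv n phi02.
      rewrite (lt_le_trans ltphi2)// /phi2 -lerBrDl ge_min lexx//.
    have := congr1 (fun t => expi phi ^+ L * t) (sum0 z phi zz phiI).
    rewrite mulr0 mulr_sumr => sum_phi; rewrite /Q horner_sum -[RHS]sum_phi.
    apply: eq_bigr => s _.
    by rewrite hornerZ hornerXn mulrCA /harmonic sph_harm_param// mulrA.
  (* This coefficient collects exactly the indices with the azimuthal order of [s0]; they share a
     nonzero power of [sg z], which cancels. *)
  have := congr1 (fun q : {poly R[i]} => q`_(ex s0)) Q0.
  rewrite /Q coef_sumMXn coef0 (eq_bigl _ _ (fun s => exE s s0)).
  rewrite (eq_bigr (fun s => a s 0 * (A z s)%:C
             * (sg z ^+ `|azimuth_of s0|)%:C)); last first.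
    by move=> s /eqP ->; rewrite rmorphM/= mulrA.
  rewrite -mulr_suml => /eqP; rewrite mulf_eq0 => /orP[/eqP//|].
  by rewrite fmorph_eq0 expf_eq0 (negbTE sg0) andbF.
pose c (f : R[i] -> R) s := f (a s 0) * sph_coef (degree_of s) (azimuth_of s).
(* The Legendre factors are real, so the real and imaginary parts of the coefficients satisfy
   separate relations; [f] stands for either part. *)
have part0 (f : R[i] -> R) :
  (forall z : R, z0 < z < z1 -> \sum_(s | azimuth_of s == azimuth_of s0)
     f (a s 0) * A z s = 0) -> f (a s0 0) = 0.
  move=> fA.
  have : c f s0 = 0.
    apply: (@polys_distinct_size_free _ _
      (fun s => azimuth_of s == azimuth_of s0)
      (fun s => legendre_deriv R (degree_of s) `|azimuth_of s|)) => //.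
    - move=> s _; rewrite -size_poly_gt0 size_legendre_deriv//.
      exact: absz_azimuth_le.
    - move=> s t /eqP es /eqP et; rewrite !size_legendre_deriv ?absz_azimuth_le//.
      have := absz_azimuth_le s; have := absz_azimuth_le t.
      rewrite es et => lt ls [dst]; apply: degree_azimuth_inj; last by rewrite es et.
      apply: val_inj => /=; move: (nat_of_ord _) (nat_of_ord _) ls lt dst => p q.
      by lia.
    - apply: (poly_eq0_of_roots (seq_between_inj z01)) => n.
      rewrite horner_sum -[RHS](fA _ (seq_between_itv n z01)).
      by apply: eq_bigr => s _; rewrite hornerZ mulrA.
  by move=> /eqP; rewrite mulf_eq0 (negbTE (sph_coef_neq0 _ _)) orbF => /eqP.
have re0 : complex.Re (a s0 0) = 0.
  apply: (part0 (@complex.Re R)) => z /A0 sumz.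
  rewrite -[RHS]/(complex.Re (0 : R[i])) -sumz Re_sum; apply: eq_bigr => s _.
  by case: (a s 0) => u v /=; rewrite mulr0 subr0.
have im0 : complex.Im (a s0 0) = 0.
  apply: (part0 (@complex.Im R)) => z /A0 sumz.
  rewrite -[RHS]/(complex.Im (0 : R[i])) -sumz Im_sum; apply: eq_bigr => s _.
  by case: (a s 0) => u v /=; rewrite mulr0 add0r.
by move: re0 im0; case: (a s0 0) => u v /= -> ->.
Qed.

End Degrees.
End SphericalHarmonics.

(** * The surface measure *)

Lemma continuous_pair (T U V : topologicalType) (f : T -> U) (g : T -> V) :
  continuous f -> continuous g -> continuous (fun x => (f x, g x)).
Proof. by move=> cf cg x; exact: (cvg_pair (cf x) (cg x)). Qed.

Section SurfaceMeasure.
Variable R : realType.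

(** Measurability and boundedness on the sphere give integrability; continuity upgrades vanishing
    almost everywhere to vanishing on an open set. *)
Definition tame (f : R * R * R -> R) : Prop :=
  [/\ continuous f, measurable_fun setT f
    & exists M, forall x, sphere R x -> `|f x| <= M].

Lemma tame_subalgebra : subalgebra_of_functions tame.
Proof.
have [cC cD cM] := @continuous_subalgebra R (R * R * R)%type.
split=> [c|f g [cf mf [M fM]] [cg mg [N gN]]|f g [cf mf [M fM]] [cg mg [N gN]]].
- by split; [exact: cC|exact: measurable_cst|exists `|c|].
- split; [exact: cD|exact: measurable_funD|exists (M + N) => x Sx].
  by rewrite (le_trans (ler_normD _ _))// lerD ?fM ?gN.
- split; [exact: cM|exact: measurable_funM|exists (M * N) => x Sx].
  by rewrite normrM ler_pM ?fM ?gN.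
Qed.

Lemma tame_coord : [/\ tame (fun x => x.1.1), tame (fun x => x.1.2)
  & tame (fun x => x.2)].
Proof.
have bnd (a b c t : R) : a ^+ 2 + b ^+ 2 + c ^+ 2 = 1 ->
    t \in [:: a; b; c] -> `|t| <= 1.
  move=> abc; rewrite !inE => t_abc; rewrite -(@expr_le1 _ 2)// real_normK ?num_real//.
  rewrite -abc; have := sqr_ge0 a; have := sqr_ge0 b; have := sqr_ge0 c.
  by case/or3P: t_abc => /eqP ->; lra.
split; split.
- by move=> x; apply: (@continuous_comp _ _ _ fst fst); exact: cvg_fst.
- by apply: measurableT_comp; exact: measurable_fst.
- by exists 1 => -[[a b] c] /= /bnd; apply; rewrite inE eqxx.
- by move=> x; apply: (@continuous_comp _ _ _ fst snd); [exact: cvg_fst|exact: cvg_snd].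
- by apply: measurableT_comp; [exact: measurable_snd|exact: measurable_fst].
- by exists 1 => -[[a b] c] /= /bnd; apply; rewrite !inE eqxx orbT.
- by move=> x; exact: cvg_snd.
- exact: measurable_snd.
- by exists 1 => -[[a b] c] /= /bnd; apply; rewrite !inE eqxx !orbT.
Qed.

Lemma measurable_sphere : measurable (sphere R).
Proof.
have alg := tame_subalgebra; have [tx ty tz] := tame_coord.
have [_ m _] : tame (fun x => x.1.1 ^+ 2 + x.1.2 ^+ 2 + x.2 ^+ 2).
  by under eq_fun do rewrite !expr2; do 2?apply: (subalgebraD alg);
    exact: (subalgebraM alg).
have := m measurableT [set 1] (measurable_set1 _).
by rewrite setTI.
Qed.

Lemma tame_integrable (D : set (R * R * R)) f : measurable D -> D `<=` sphere R ->
  tame f -> (surface R).-integrable D (EFin \o f).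
Proof.
move=> mD DS [_ mf [M fM]]; apply: measurable_bounded_integrable => //.
- apply: (@le_lt_trans _ _ (surface R (sphere R))).
    by apply: le_measure; rewrite ?inE//; exact: measurable_sphere.
  by rewrite surface_sphere ltry.
- exact: measurable_funTS.
- exists M; split; first exact: num_real.
  by move=> b Mb x Dx; apply: (le_trans (fM _ (DS _ Dx))); exact: ltW.
Qed.

Lemma sphere_param_surj x : sphere R x ->
  exists2 u, param_domain u & sphere_param u = x.
Proof.
case: x => [[a b] c]; rewrite /sphere/= => abc.
have c2 : 1 - c ^+ 2 = a ^+ 2 + b ^+ 2 by lra.
have c_itv : -1 <= c <= 1.
  rewrite -ler_norml -(@expr_le1 _ 2)// real_normK ?num_real// -subr_ge0 c2.
  by rewrite addr_ge0 ?sqr_ge0.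
(* At the poles every longitude is admissible and 0 is chosen. Elsewhere the longitude is the
   arccosine of [a / s], reflected to the other half of the circle when [b] is negative. *)
have [s0|sN0] := eqVneq (Num.sqrt (a ^+ 2 + b ^+ 2)) 0.
  have /eqP : a ^+ 2 + b ^+ 2 = 0.
    by apply/eqP; rewrite eq_le addr_ge0 ?sqr_ge0// andbT -sqrtr_eq0 s0.
  rewrite paddr_eq0 ?sqr_ge0// !sqrf_eq0 => /andP[/eqP a0 /eqP b0].
  exists (c, 0); first by split; rewrite /= in_itv/= ?c_itv// lexx mulr_ge0 ?pi_ge0.
  by rewrite /sphere_param /= c2 s0 !mul0r a0 b0.
set s := Num.sqrt _ in sN0; have s_gt0 : 0 < s by rewrite lt_neqAle eq_sym sN0 sqrtr_ge0.
have s2 : s ^+ 2 = a ^+ 2 + b ^+ 2 by rewrite sqr_sqrtr// addr_ge0 ?sqr_ge0.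
pose t := a / s.
have t_itv : -1 <= t <= 1.
  rewrite -ler_norml -(@expr_le1 _ 2)// real_normK ?num_real// expr_div_n.
  by rewrite ler_pdivrMr ?exprn_gt0// mul1r s2 lerDl sqr_ge0.
have st : s * t = a by rewrite mulrC divfK.
have sint : s * Num.sqrt (1 - t ^+ 2) = `|b|.
  rewrite -sqrtr_sqr -[s in LHS]ger0_norm ?(ltW s_gt0)// -sqrtr_sqr -sqrtrM ?sqr_ge0//.
  by congr Num.sqrt; rewrite mulrBr mulr1 -exprMn st s2; ring.
have tin : t \in `[-1, 1] by rewrite in_itv.
have := acos_ge0 t_itv; have := acos_lepi t_itv => le_pi ge_0.
have pi0 := pi_ge0 R.
have [b0|b0] := leP 0 b.
  exists (c, acos t); first by split; rewrite /= in_itv//= ge_0/=; lra.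
  by rewrite /sphere_param /= c2 -/s acosK// sin_acos// st sint ger0_norm.
exists (c, - acos t + pi *+ 2); first by split; rewrite /= in_itv//=; lra.
rewrite /sphere_param /= c2 -/s cosD2pi sinD2pi cosN sinN acosK// sin_acos//.
by rewrite st mulrN sint ltr0_norm// opprK.
Qed.

Lemma sphere_param_continuous : continuous (fun u : R * R => sphere_param u).
Proof.
have alg := @continuous_subalgebra R (R * R)%type.
have cs : continuous (fun u : R * R => Num.sqrt (1 - u.1 ^+ 2)).
  move=> v; apply: (@continuous_comp _ _ _ (fun v : R * R => 1 - v.1 ^+ 2)); last first.
    exact: sqrt_continuous.
  have c1 : continuous (fun v : R * R => v.1) by move=> w; exact: cvg_fst.
  suff : continuous (fun v : R * R => 1 - v.1 ^+ 2) by exact.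
  under eq_fun do rewrite expr2.
  apply: (subalgebraD alg (subalgebra_cst alg 1)).
  by apply: (subalgebraN alg); exact: (subalgebraM alg).
have cc : continuous (fun u : R * R => cos u.2).
  by move=> v; apply: (@continuous_comp _ _ _ snd); [exact: cvg_snd|exact: continuous_cos].
have csi : continuous (fun u : R * R => sin u.2).
  by move=> v; apply: (@continuous_comp _ _ _ snd); [exact: cvg_snd|exact: continuous_sin].
apply: (@continuous_pair _ (R * R)%type R); last by move=> v; exact: cvg_fst.
by apply: (@continuous_pair _ R R); exact: (subalgebraM alg).
Qed.

(** A small step from [x] towards the midpoint; the bound [(b - a) / 4] prevents overshooting the
    far endpoint. *)
Lemma itv_interior_near (a b x e : R) : a < b -> a <= x <= b -> 0 < e ->
  exists2 y, a < y < b & `|x - y| < e.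
Proof.
move=> ab xab e0; pose d := Num.min (e / 2) ((b - a) / 4).
have d0 : 0 < d by rewrite lt_min !divr_gt0 ?subr_gt0.
have de : d < e by rewrite gt_min ltr_pdivrMr// ltr_pMr// ltr1n.
have dba : d <= (b - a) / 4 by rewrite ge_min lexx orbT.
have [xm|xm] := leP x ((a + b) / 2).
  by exists (x + d); [lra|rewrite opprD addNKr normrN gtr0_norm].
by exists (x - d); [lra|rewrite opprB addrC subrK gtr0_norm].
Qed.

(** [V] contains an open square around [u], whose positive area would bound the surface measure of
    [N] from below. *)
Lemma surface_null_nbhs (N : set (R * R * R)) (V : set (R * R)) (u : R * R) :
  measurable N -> surface R N = 0%E -> nbhs u V ->
  (forall v, V v -> param_domain v /\ N (sphere_param v)) -> False.
Proof.
move=> mN N0 /nbhs_ballP[e /= e0 eV] VN.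
pose B : set (measurableTypeR R * measurableTypeR R) :=
  [set` `]u.1 - e, u.1 + e[] `*` [set` `]u.2 - e, u.2 + e[].
have mB : measurable B by apply: measurableX; exact: measurable_itv.
have BV : B `<=` V.
  by move=> v [v1 v2]; apply: eV; split; rewrite ball_itv.
have Blt : ((lebesgue_measure \x lebesgue_measure) B <= surface R N)%E.
  apply: le_measure; rewrite ?inE//.
    apply: measurableI; last exact: measurable_param_domain.
    by rewrite -[X in measurable X]setTI; exact: measurable_sphere_param.
  by move=> v /BV/VN[].
move: Blt; rewrite N0 product_measure1E//; try exact: measurable_itv.
rewrite /= !lebesgue_measure_itv/= !lte_fin !ltrBlDr -!addrA !ltrDl addr_gt0//.
rewrite -!EFinB -EFinM lee_fin leNgt; apply/negP; rewrite negbK.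
by apply: mulr_gt0; lra.
Qed.

(** A nonnegative integrand with zero integral vanishes off a null set. A nonzero value over the
    open part would persist on a parameter neighbourhood, contradicting [surface_null_nbhs]. *)
Lemma tame_integral_eq0 (D U : set (R * R * R)) (f : R * R * R -> R) :
  measurable D -> D `<=` sphere R ->
  open U -> U `&` sphere R !=set0 -> U `&` sphere R `<=` D ->
  tame f -> (forall x, 0 <= f x) -> \int[surface R]_(x in D) f x = 0 ->
  exists a b c d : R,
    [/\ forall z : R, a < z < b -> -1 < z < 1, a < b, c < d
      & forall z phi : R, a < z < b -> c < phi < d -> f (sphere_param (z, phi)) = 0].
Proof.
move=> mD DS oU [x [Ux Sx]] UD tf f0 intf0.
have intf := tame_integrable mD DS tf; have [cf mf _] := tf.
have : (\int[surface R]_(x in D) `|(f x)%:E|)%E = 0%E.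
  under eq_integral do rewrite gee0_abs ?lee_fin//.
  by rewrite -[LHS]fineK ?integrable_fin_num// -[fine _]/(Rintegral _ _ _) intf0.
move/(ae_eq_integral_abs _ mD); case.
  by apply/measurable_EFinP; exact: measurable_funTS.
move=> N [mN N0 fN].
pose W : set (R * R) := (fun u : R * R => sphere_param u) @^-1` U.
have cp := sphere_param_continuous.
have oW : open W by apply: open_comp => // u _; exact: cp.
pose I : set (R * R) := [set` `]-1, 1[] `*` [set` `]0, 2 * pi[].
have oI : open I.
  rewrite /I (_ : _ `*` _ = fst @^-1` [set` `]-1, 1[] `&` snd @^-1` [set` `]0, 2 * pi[])//.
  apply: openI; apply: open_comp; try exact: interval_open.
    by move=> u _; exact: cvg_fst.
  by move=> u _; exact: cvg_snd.
have ID u : I u -> param_domain u.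
  by move=> [] /=; rewrite !in_itv/= => /andP[? ?] /andP[? ?]; split;
    rewrite /= in_itv/= !ltW.
have [u0 [/= u01 u02] u0x] := sphere_param_surj Sx.
have /nbhs_ballP[e /= e0 eW] : nbhs (u0 : R * R) W.
  by apply: open_nbhs_nbhs; split=> //; rewrite /W/= u0x.
(* The parameters [u0] may lie on the boundary of the closed rectangle; they are replaced by nearby
   interior ones still mapped into [U]. *)
have [v1 v1I v1u] : exists2 y, -1 < y < 1 & `|u0.1 - y| < e.
  by apply: itv_interior_near => //; lra.
have [v2 v2I v2u] : exists2 y, 0 < y < 2 * pi & `|u0.2 - y| < e.
  by apply: itv_interior_near => //; rewrite mulr_gt0// pi_gt0.
have WIv : nbhs ((v1, v2) : R * R) (W `&` I).
  apply: open_nbhs_nbhs; split; first exact: openI.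
  by split; [exact: eW|split; rewrite /= in_itv].
move/nbhs_ballP: WIv => [r /= r0 rWI].
have rectWI (z phi : R) : v1 - r < z < v1 + r -> v2 - r < phi < v2 + r ->
    (W `&` I) (z, phi).
  by move=> zr phir; apply: rWI; split; rewrite ball_itv/= in_itv.
exists (v1 - r), (v1 + r), (v2 - r), (v2 + r); split; try lra.
  move=> z /(rectWI z v2) [|_ [+ _]]; first lra.
  by rewrite /= in_itv.
move=> z phi zr phir; apply/eqP; apply: contraT => fN0.
(* All points of [V] are mapped into [D] and have [f] nonzero, hence land in the exceptional null
   set [N]. *)
pose V : set (R * R) :=
  (W `&` I) `&` (fun u : R * R => f (sphere_param u)) @^-1` [set t | t != 0].
apply: False_ind; apply: (@surface_null_nbhs N V (z, phi)) => //.
  apply: open_nbhs_nbhs; split; last by split; [exact: rectWI|].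
  apply: openI; first exact: openI.
  apply: open_comp; last exact: open_neq.
  by move=> u _; apply: (@continuous_comp _ _ _ (fun u : R * R => sphere_param u));
    [exact: cp|exact: cf].
move=> v [[Wv Iv] /= fv]; split; first exact: ID.
apply: fN => /= fD; move/eqP: fv; apply.
suff /fD [] : D (sphere_param v) by [].
apply: UD; split=> //.
rewrite /sphere /=.
move: Iv => [/= + _]; rewrite in_itv/= => /andP[v10 v11].
rewrite !exprMn -mulrDr cos2Dsin2 mulr1 sqr_sqrtr ?subrK// subr_ge0.
by rewrite -real_normK ?num_real// expr_le1// ler_norml !ltW.
Qed.
End SurfaceMeasure.

(** * Positive definiteness of the Gram matrix *)

Section HarmonicGramMatrix.
Variables (R : realType) (Gamma : set (R * R * R)).
Hypotheses (mGamma : measurable Gamma) (Gamma_sphere : Gamma `<=` sphere R).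
Local Open Scope complex_scope.
Notation ctame := (componentwise (@tame R)).

Lemma RintegralD_tame f g : tame f -> tame g ->
  \int[surface R]_(x in Gamma) (f x + g x) =
  \int[surface R]_(x in Gamma) f x + \int[surface R]_(x in Gamma) g x.
Proof. by move=> tf tg; apply: RintegralD => //; exact: tame_integrable. Qed.

Lemma RintegralZ_tame (c : R) f : tame f ->
  \int[surface R]_(x in Gamma) (c * f x) = c * \int[surface R]_(x in Gamma) f x.
Proof. by move=> tf; apply: RintegralZl => //; exact: tame_integrable. Qed.

Lemma CintegralD f g : ctame f -> ctame g ->
  Cintegral Gamma (fun x => f x + g x) = Cintegral Gamma f + Cintegral Gamma g.
Proof.
move=> [rf If] [rg Ig]; rewrite /Cintegral.
rewrite -[RHS]/((_ + _) +i* (_ + _)) -!RintegralD_tame//.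
by congr (_ +i* _); apply: eq_Rintegral => x _; case: (f x) (g x) => ? ? [].
Qed.

Lemma CintegralZ (c : R[i]) f : ctame f ->
  Cintegral Gamma (fun x => c * f x) = c * Cintegral Gamma f.
Proof.
move=> [rf If]; case: c => u v; rewrite /Cintegral.
have alg := tame_subalgebra R.
have tZ (w : R) h : tame h -> tame (fun x => w * h x).
  by move=> th; apply: (subalgebraM alg) => //; exact: (subalgebra_cst alg).
have lin (w w' : R) : \int[surface R]_(x in Gamma)
      (w * complex.Re (f x) + w' * complex.Im (f x)) =
    w * \int[surface R]_(x in Gamma) complex.Re (f x)
    + w' * \int[surface R]_(x in Gamma) complex.Im (f x).
  by rewrite RintegralD_tame ?RintegralZ_tame//; exact: tZ.
rewrite -[RHS]/((_ - _) +i* (_ + _)) -mulNr [u * _ + v * _]addrC -!lin.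
by congr (_ +i* _); apply: eq_Rintegral => x _; case: (f x) => ? ? /=; ring.
Qed.

Lemma Cintegral_sum (I : Type) (r : seq I) (F : I -> R * R * R -> R[i]) :
  (forall i, ctame (F i)) ->
  Cintegral Gamma (fun x => \sum_(i <- r) F i x) = \sum_(i <- r) Cintegral Gamma (F i).
Proof.
move=> tF; elim: r => [|i r IH].
  rewrite big_nil /Cintegral.
  have int0 (f : R * R * R -> R) : (forall x, f x = 0) ->
      \int[surface R]_(x in Gamma) f x = 0.
    by move=> f0; under eq_Rintegral do rewrite f0; rewrite Rintegral_cst ?mul0r.
  by rewrite !int0// => x; rewrite big_nil.
rewrite big_cons -IH -CintegralD//; last first.
  exact: (componentwise_sum (tame_subalgebra R)).
by congr Cintegral; apply/funext => x; rewrite big_cons.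
Qed.

Lemma Cintegral_conj f : ctame f ->
  Cintegral Gamma (fun x => Num.conj (f x)) = Num.conj (Cintegral Gamma f).
Proof.
move=> [_ If]; rewrite /Cintegral -[RHS]/(_ +i* (- _)) -mulN1r -RintegralZ_tame//.
by congr (_ +i* _); apply: eq_Rintegral => x _; case: (f x) => ? ? //=; rewrite mulN1r.
Qed.

Lemma sph_harm_tame l m : ctame (sph_harm l m).
Proof.
have alg := tame_subalgebra R; have [tx ty tz] := tame_coord R.
have horner_tame (q : {poly R}) : tame (fun x => q.[x.2]).
  elim/poly_ind: q => [|q c IH].
    by under eq_fun do rewrite horner0; exact: (subalgebra_cst alg).
  under eq_fun do rewrite hornerMXaddC.
  apply: (subalgebraD alg); last exact: (subalgebra_cst alg).
  exact: (subalgebraM alg).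
have nat_tame k : ctame (sph_harm_nat l k).
  apply: (componentwiseM alg); last exact: (componentwiseX alg).
  split; last exact: (subalgebra_cst alg).
  by apply: (subalgebraM alg) => //; exact: (subalgebra_cst alg).
case: m => k; first exact: nat_tame.
by apply: (componentwiseM alg); [exact: (componentwise_cst alg)|exact: (componentwise_conj alg)].
Qed.

Variable L : nat.

Lemma harmonic_tame s : ctame (@harmonic R L s).
Proof. exact: sph_harm_tame. Qed.

Lemma YhatE s t : Yhat Gamma L s t =
  Cintegral Gamma (fun x => Num.conj (harmonic s x) * harmonic t x).
Proof. by rewrite mxE mxE. Qed.

Lemma Yhat_hermitian s t : Num.conj (Yhat Gamma L s t) = Yhat Gamma L t s.
Proof.
have alg := tame_subalgebra R; rewrite !YhatE -Cintegral_conj; last first.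
  by apply: (componentwiseM alg); [apply: (componentwise_conj alg)|]; exact: harmonic_tame.
congr Cintegral; apply/funext => x.
by rewrite mulrC -[in RHS](conjCK (harmonic s x)); exact: rmorphM.
Qed.

Definition harmonic_sum (a : 'cV[R[i]]_(dimL L)) x : R[i] := \sum_s a s 0 * harmonic s x.

Lemma harmonic_sum_tame a : ctame (harmonic_sum a).
Proof.
have alg := tame_subalgebra R.
apply: (componentwise_sum alg) => s.
by apply: (componentwiseM alg); [exact: (componentwise_cst alg)|exact: harmonic_tame].
Qed.

(** Expanding the squared modulus of the harmonic sum as a double sum and integrating term by term
    produces the Gram entries. *)
Lemma Yhat_quad (a : 'cV[R[i]]_(dimL L)) :
  complex.Re ((map_mx Num.conj a^T *m Yhat Gamma L *m a) 0 0) =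
  \int[surface R]_(x in Gamma) ComplexField.Normc.normc (harmonic_sum a x) ^+ 2.
Proof.
have alg := tame_subalgebra R.
have tYY (s t : 'I_(dimL L)) : ctame (fun x => Num.conj (harmonic s x) * harmonic t x).
  by apply: (componentwiseM alg); [apply: (componentwise_conj alg)|]; exact: harmonic_tame.
have -> : (map_mx Num.conj a^T *m Yhat Gamma L *m a) 0 0 =
    Cintegral Gamma (fun x => Num.conj (harmonic_sum a x) * harmonic_sum a x).
  transitivity (Cintegral Gamma (fun x => \sum_t \sum_s
      (Num.conj (a s 0) * a t 0) * (Num.conj (harmonic s x) * harmonic t x))).
    rewrite Cintegral_sum => [|t]; last first.
      apply: (componentwise_sum alg) => s.
      by apply: (componentwiseM alg); [exact: (componentwise_cst alg)|exact: tYY].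
    rewrite mxE; apply: eq_bigr => t _; rewrite Cintegral_sum => [|s]; last first.
      by apply: (componentwiseM alg); [exact: (componentwise_cst alg)|exact: tYY].
    rewrite mxE mulr_suml; apply: eq_bigr => s _.
    by rewrite CintegralZ; [rewrite YhatE !mxE mulrAC|exact: tYY].
  congr Cintegral; apply/funext => x; rewrite /harmonic_sum mulr_sumr.
  apply: eq_bigr => t _; rewrite [Num.conj _]raddf_sum mulr_suml.
  apply: eq_bigr => s _.
  transitivity (Num.conj (a s 0) * Num.conj (harmonic s x) * (a t 0 * harmonic t x)).
    by ring.
  by congr (_ * _); apply/esym; exact: rmorphM.
apply: eq_Rintegral => x _; rewrite normc_sqr.
by case: (harmonic_sum a x) => u v /=; ring.
Qed.

Hypothesis Gamma_open : exists U : set (R * R * R),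
  [/\ open U, U `&` sphere R !=set0 & U `&` sphere R `<=` Gamma].

Lemma Yhat_quad_ge0 (a : 'cV[R[i]]_(dimL L)) :
  0 <= complex.Re ((map_mx Num.conj a^T *m Yhat Gamma L *m a) 0 0).
Proof. by rewrite Yhat_quad; apply: Rintegral_ge0 => x _; exact: sqr_ge0. Qed.

Lemma Yhat_quad_eq0 (a : 'cV[R[i]]_(dimL L)) :
  complex.Re ((map_mx Num.conj a^T *m Yhat Gamma L *m a) 0 0) = 0 -> a = 0.
Proof.
rewrite Yhat_quad => int0; have [U [oU U0 UG]] := Gamma_open.
have alg := tame_subalgebra R.
have tf : tame (fun x => ComplexField.Normc.normc (harmonic_sum a x) ^+ 2).
  under eq_fun do rewrite normc_sqr !expr2.
  have [tr ti] := harmonic_sum_tame a.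
  by apply: (subalgebraD alg); exact: (subalgebraM alg).
have [z0 [z1 [p0 [p1 [zI z01 p01 h0]]]]] :=
  tame_integral_eq0 mGamma Gamma_sphere oU U0 UG tf (fun x => sqr_ge0 _) int0.
apply: (harmonics_free zI z01 p01) => z phi zz pp.
by apply: ComplexField.Normc.eq0_normc; apply/eqP; rewrite -sqrf_eq0 h0.
Qed.

Lemma Yhat_unitmx : Yhat Gamma L \in unitmx.
Proof.
rewrite -row_free_unit -kermx_eq0; apply/rowV0P => u /sub_kermxP uY.
(* A left kernel row [u] is the conjugate transpose of a column at which the quadratic form
   vanishes, so definiteness applies. *)
have -> : u = map_mx Num.conj (map_mx Num.conj u^T)^T.
  by apply/matrixP => i j; rewrite !mxE conjCK.
suff -> : map_mx Num.conj u^T = 0 by apply/matrixP => i j; rewrite !mxE rmorph0.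
apply: Yhat_quad_eq0.
have -> : map_mx Num.conj (map_mx Num.conj u^T)^T = u.
  by apply/matrixP => i j; rewrite !mxE conjCK.
by rewrite uY mul0mx mxE.
Qed.

End HarmonicGramMatrix.

(** * The penalized problem *)

(* Stated over an abstract field: for [R[i]] the various inheritance paths to its ring
   structure make conversion very slow. *)
Section HermitianForms.
Variables (K : numClosedFieldType) (n : nat).
Implicit Types (Y : 'M[K]_n) (h c d : 'cV[K]_n).

Lemma hermitian_form_conj Y c d : (forall s t, Num.conj (Y s t) = Y t s) ->
  (map_mx Num.conj c^T *m Y *m d) 0 0 =
  Num.conj ((map_mx Num.conj d^T *m Y *m c) 0 0).
Proof.
move=> Yherm; rewrite -mulmxA !mxE rmorph_sum; apply: eq_bigr => s _.
rewrite rmorphM mulrC !mxE; congr (_ * _).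
rewrite rmorph_sum; apply: eq_bigr => t _.
by rewrite rmorphM/= !mxE conjCK Yherm mulrC.
Qed.

Lemma conj_trmxD c d :
  map_mx Num.conj (c + d)^T = map_mx Num.conj c^T + map_mx Num.conj d^T.
Proof. by apply/matrixP => i j; rewrite !mxE rmorphD. Qed.

(** The two cross terms are conjugate to each other and, since [Y *m c = h], are expressed through
    [h]; the linear part of [gfun] cancels them. *)
Lemma hermitian_formD Y h c d :
  (forall s t, Num.conj (Y s t) = Y t s) -> Y *m c = h ->
  let l := (map_mx Num.conj d^T *m h) 0 0 in
  (map_mx Num.conj (c + d)^T *m Y *m (c + d)) 0 0 =
  (map_mx Num.conj c^T *m Y *m c) 0 0 + (map_mx Num.conj d^T *m Y *m d) 0 0
    + (l + Num.conj l).
Proof.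
move=> Yherm <- /=; rewrite [in RHS]mulmxA -hermitian_form_conj// conj_trmxD.
have D (u v : 'M[K]_1) : (u + v) 0 0 = u 0 0 + v 0 0 by rewrite mxE.
by rewrite !mulmxDl !mulmxDr !D; ring.
Qed.

Lemma conj_mulmxDl h c d : (map_mx Num.conj (c + d)^T *m h) 0 0 =
  (map_mx Num.conj c^T *m h) 0 0 + (map_mx Num.conj d^T *m h) 0 0.
Proof. by rewrite conj_trmxD mulmxDl mxE. Qed.

End HermitianForms.

Section Penalty.
Variable R : realType.
Local Open Scope complex_scope.

Lemma dist_to_minimizer n (S : set 'cV[R[i]]_n) a z :
  minimizer (fun y => l2norm (a - y)) S z -> l2norm (a - z) <= dist_to a S.
Proof.
move=> [Sz zmin]; apply: lb_le_inf; first by exists (l2norm (a - z)), z.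
by move=> _ [y Sy <-]; exact: zmin.
Qed.

(** In dimension 1 the real part of the form is a multiple of the squared norm. The nonzero vector
    allows the sign of the multiple to be read off from definiteness. *)
Lemma dimL0_quad (Y : 'M[R[i]]_(dimL 0)) : exists2 y : R,
  (forall d : 'cV_(dimL 0),
    complex.Re ((map_mx Num.conj d^T *m Y *m d) 0 0) = y * l2norm d ^+ 2)
  & exists d : 'cV[R[i]]_(dimL 0), d != 0.
Proof.
move: Y; rewrite (dimLE 0) => Y; exists (complex.Re (Y 0 0)).
  move=> d; rewrite l2norm_sqr big_ord1 normc_sqr -mulmxA !mxE !big_ord1 !mxE big_ord1.
  by case: (Y 0 0) (d 0 0) => y1 y2 [u v] /=; ring.
exists (const_mx 1); apply/eqP => /matrixP/(_ 0 0)/eqP.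
by rewrite !mxE oner_eq0.
Qed.

(* Equality throughout is forced in |c| <= |astar| + |astar - c|: [astar] lies on the
   segment from 0 to the centre [c], hence so does its projection on the ball. *)
Lemma penalty_proj_ball n (c astar z : 'cV[R[i]]_n) (g : 'cV[R[i]]_n -> R)
    (y k p lambda : R) :
  0 < p -> 0 < y -> 0 < lambda -> k <= 0 ->
  (forall a, g a = k + y * l2norm (a - c) ^+ 2) ->
  (forall a, l2norm astar `^ p + lambda * pos_part (g astar)
    <= l2norm a `^ p + lambda * pos_part (g a)) ->
  minimizer (fun a => l2norm (astar - a)) [set a | g a <= 0] z ->
  forall w, g w <= 0 -> l2norm z <= l2norm w.
Proof.
move=> p0 y0 lambda0 k0 gE Fmin [gz zmin] w gw.
have pos0 a : g a <= 0 -> pos_part (g a) = 0 by move=> ga; exact/max_idPr.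
have powle (a b : 'cV[R[i]]_n) : l2norm a `^ p <= l2norm b `^ p -> l2norm a <= l2norm b.
  move=> ab; rewrite leNgt; apply/negP => /(gt0_ltr_powR p0).
  by rewrite !nnegrE !l2norm_ge0 ltNge ab => /(_ isT isT).
(* A feasible [astar] is its own projection, and the penalty vanishes on both sides of the
   comparison. *)
have [gs|gs] := leP (g astar) 0.
  have /l2norm_eq0/eqP : l2norm (astar - z) = 0.
    by apply/eqP; rewrite eq_le l2norm_ge0 (le_trans (zmin _ gs)) ?subrr ?l2norm0.
  rewrite subr_eq0 => /eqP <-; apply: powle.
  by have := Fmin w; rewrite !pos0// mulr0 !addr0.
(* [r] is the radius of the feasible ball around [c]. *)
pose r := Num.sqrt (- k / y); pose rho := l2norm (astar - c).
have r0 : 0 <= r by exact: sqrtr_ge0.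
have r2 : r ^+ 2 = - k / y by rewrite sqr_sqrtr// divr_ge0 ?oppr_ge0// ltW.
have feasE a : (g a <= 0) = (l2norm (a - c) <= r).
  rewrite -[RHS](@ler_pXn2r _ 2)// ?nnegrE ?l2norm_ge0// r2 ler_pdivlMr//.
  by rewrite gE mulrC -lerBrDl sub0r.
have gc : g c <= 0 by rewrite feasE subrr l2norm0.
have r_rho : r < rho by move: gs; rewrite ltNge feasE -ltNge.
have rho0 : 0 < rho by exact: le_lt_trans r0 r_rho.
have Fpos : 0 < lambda * pos_part (g astar).
  by rewrite mulr_gt0// lt_max gs.
have s_c : l2norm astar <= l2norm c.
  apply: powle; have := Fmin c; rewrite (pos0 c)// mulr0 addr0.
  by apply: le_trans; rewrite lerDl ltW.
have c0 : 0 < l2norm c.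
  rewrite lt_neqAle eq_sym l2norm_ge0 andbT; apply/eqP => c0.
  have s0 : l2norm astar = 0 by apply/eqP; rewrite eq_le l2norm_ge0 -{1}c0 s_c.
  by move: gs; rewrite (l2norm_eq0 s0) -(l2norm_eq0 c0) ltNge gc.
have rho_le : rho <= l2norm c - l2norm astar.
  (* The point of the segment from 0 to [c] with the norm of [astar]: minimality forces [astar] to
     be at least as close to [c]. *)
  pose a := (l2norm astar / l2norm c)%:C *: c.
  have na : l2norm a = l2norm astar.
    by rewrite l2normZ ?divr_ge0 ?l2norm_ge0// divfK// gt_eqF.
  have nac : l2norm (a - c) = l2norm c - l2norm astar.
    have -> : a - c = - ((1 - l2norm astar / l2norm c)%:C *: c).
      by rewrite /a rmorphB rmorph1 scalerBl scale1r opprB.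
    rewrite l2normN l2normZ; last by rewrite subr_ge0 ler_pdivrMr// mul1r.
    by rewrite mulrBl mul1r divfK// gt_eqF.
  have := Fmin a; rewrite na lerD2l ler_pM2l// => le_pos.
  have gsa : g astar <= g a.
    move: le_pos; rewrite {1}/pos_part (max_idPl (ltW gs)) /pos_part le_max.
    by case/orP => //; rewrite leNgt gs.
  move: gsa; rewrite !gE lerD2l ler_pM2l// nac.
  by rewrite ler_pXn2r ?nnegrE ?l2norm_ge0// subr_ge0.
(* The point where the segment from [c] to [astar] leaves the ball; it bounds the distance to the
   projection by [rho - r]. *)
pose w' := c + (r / rho)%:C *: (astar - c).
have nz : l2norm (astar - z) <= rho - r.
  have -> : rho - r = l2norm (astar - w').
    have -> : astar - w' = (1 - r / rho)%:C *: (astar - c).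
      by rewrite rmorphB rmorph1 scalerBl scale1r /w' opprD addrA.
    rewrite l2normZ; last by rewrite subr_ge0 ler_pdivrMr// mul1r ltW.
    by rewrite -/rho mulrBl mul1r divfK// gt_eqF.
  apply: zmin => /=; rewrite feasE /w' addrAC subrr add0r l2normZ; last first.
    by rewrite divr_ge0// ltW.
  by rewrite -/rho divfK// gt_eqF.
have zs : l2norm z <= l2norm (astar - z) + l2norm astar.
  by rewrite l2normB -{1}(subrK astar z) l2normD.
have cw : l2norm c <= r + l2norm w.
  rewrite -{1}(subrK w c) (le_trans (l2normD _ _))// lerD2r l2normB.
  by rewrite -feasE.
lra.
Qed.

(** [t] is a distance to the feasible set, [gs] the constraint violation and [m] an objective value.
    From [lambda * t <= C * m] and the lower bound on [lambda], [B ^ (1/p) * t <= K ^ (1/p)]; then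
    take [p]-th powers. *)
Lemma penalty_bound (B C K m t gs lambda p : R) :
  0 < p -> 0 <= B -> 0 < K -> 0 < C -> 0 < lambda -> 0 <= t ->
  lambda * gs <= m -> t <= C * gs ->
  C * B `^ (1 / p) * K `^ (- (1 / p)) * m <= lambda -> B * t `^ p <= K.
Proof.
move=> p0 B0 K0 C0 lambda0 t0 gs_m t_gs hlambda.
have Kp : 0 < K `^ (1 / p) by exact: powR_gt0.
have BtK : B `^ (1 / p) * t <= K `^ (1 / p).
  rewrite -(ler_pM2r lambda0).
  apply: (@le_trans _ _ (B `^ (1 / p) * (C * m))).
    rewrite -mulrA ler_wpM2l ?powR_ge0// (@le_trans _ _ (C * gs * lambda))//.
      by rewrite ler_wpM2r// ltW.
    by rewrite -mulrA ler_wpM2l ?(ltW C0)// [leLHS]mulrC.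
  apply: le_trans (ler_wpM2l (ltW Kp) hlambda).
  rewrite powRN le_eqVlt; apply/orP; left; apply/eqP.
  by field; rewrite gt_eqF.
have rootK (x : R) : 0 <= x -> (x `^ (1 / p)) `^ p = x.
  by move=> x0; rewrite -powRrM div1r mulVf ?gt_eqF// powRr1.
rewrite -[B in leLHS](rootK _ B0) -[leRHS](rootK _ (ltW K0)) -powRM ?powR_ge0//.
by apply: ge0_ler_powR; rewrite ?nnegrE ?mulr_ge0 ?powR_ge0// ltW.
Qed.

(** * The objective: subadditivity, growth and continuity *)

Section Objective.
Variables (p eta : R).
Hypotheses (p0 : 0 < p) (p1 : p < 1) (eta1 : 1 < eta).
Variable L : nat.
Implicit Types a b : 'cV[R[i]]_(dimL L).

Lemma beta_weight_ge1 l : 1 <= beta_weight p eta l.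
Proof.
case: l => [|l] //=; apply: mulr_ege1; first by rewrite exprn_ege1// ltW.
by rewrite -{1}(powRr0 l.+1%:R) ler_powR ?(ltW p0)// ler1n.
Qed.

Lemma beta_weight_ge0 l : 0 <= beta_weight p eta l.
Proof. exact: le_trans ler01 (beta_weight_ge1 l). Qed.

(** The weights increase with the degree. For [L = 0] the right-hand side would be 0 while the
    weight of degree 0 is 1. *)
Lemma beta_weight_le l : (0 < L)%N -> (l <= L)%N ->
  beta_weight p eta l <= eta ^+ L * L%:R `^ p.
Proof.
case: L => // M _; case: l => [|l] lM; first exact: (beta_weight_ge1 M.+1).
rewrite ler_pM ?powR_ge0 ?exprn_ge0 ?(le_trans ler01 (ltW eta1))//.
  by apply: ler_weXn2l => //; exact: ltW.
by apply: ge0_ler_powR; rewrite ?nnegrE ?ler_nat// ltW.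
Qed.

Lemma Phi_triangle a b : Phi p eta L (a + b) <= Phi p eta L a + Phi p eta L b.
Proof.
rewrite -big_split; apply: ler_sum => l _ /=; rewrite -mulrDr.
rewrite ler_wpM2l ?beta_weight_ge0// (le_trans _ (powRD_le _ _ p0 (ltW p1))) ?l2norm_ge0//.
apply: ge0_ler_powR; rewrite ?nnegrE ?addr_ge0 ?l2norm_ge0// ?(ltW p0)//.
by rewrite /coef_block submxcolD; exact: l2normD.
Qed.

Lemma l2norm_coef_block_le a l : l2norm (coef_block a l) `^ p <= Phi p eta L a.
Proof.
rewrite /Phi (bigD1 l)//=; apply: (@le_trans _ _
  (beta_weight p eta l * l2norm (coef_block a l) `^ p)).
  by rewrite ler_peMl ?powR_ge0// beta_weight_ge1.
by rewrite lerDl; apply: sumr_ge0 => i _; rewrite mulr_ge0 ?beta_weight_ge0 ?powR_ge0.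
Qed.

Lemma Phi_ge0 a : 0 <= Phi p eta L a.
Proof. by apply: sumr_ge0 => i _; rewrite mulr_ge0 ?beta_weight_ge0 ?powR_ge0. Qed.

(** Each weight is bounded by the top one; the power mean inequality with exponent [p / 2] is then
    applied to the squared norms of the [L + 1] blocks, which sum to the squared norm of [a]. *)
Lemma Phi_le_l2norm a : (0 < L)%N ->
  Phi p eta L a <=
    eta ^+ L * L%:R `^ p * (L.+1%:R `^ (1 - p / 2) * l2norm a `^ p).
Proof.
move=> L0; have sq (x : R) : 0 <= x -> (x ^+ 2) `^ (p / 2) = x `^ p.
  by move=> x0; rewrite -powR_mulrn// -powRrM mulrCA divff ?pnatr_eq0// mulr1.
apply: (@le_trans _ _ (eta ^+ L * L%:R `^ p * \sum_l l2norm (coef_block a l) `^ p)).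
  rewrite mulr_sumr; apply: ler_sum => l _.
  by rewrite ler_wpM2r ?powR_ge0// beta_weight_le// -ltnS.
rewrite ler_wpM2l ?mulr_ge0 ?powR_ge0 ?exprn_ge0 ?(le_trans ler01 (ltW eta1))//.
under eq_bigr do rewrite -sq ?l2norm_ge0//.
rewrite -sq ?l2norm_ge0// -l2norm_coef_block.
apply: sum_powR_le => // [l||]; [exact: sqr_ge0|by rewrite divr_gt0|].
by rewrite ltr_pdivrMr// mul1r (lt_trans p1)// ltr1n.
Qed.

Lemma Phi_coercive M : exists B, forall a, Phi p eta L a <= M -> l2norm a <= B.
Proof.
(* [B0] bounds each block because the weights are at least 1; the factor [L + 1] generously replaces
   its square root. *)
pose B0 := `|M| `^ p^-1; exists (L.+1%:R * B0) => a aM.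
have B00 : 0 <= B0 by exact: powR_ge0.
have le_B0 l : l2norm (coef_block a l) <= B0.
  rewrite -[leLHS](powRr1 (l2norm_ge0 _)) -(mulfV (lt0r_neq0 p0)) powRrM.
  apply: ge0_ler_powR; rewrite ?nnegrE ?powR_ge0 ?invr_ge0 ?(ltW p0)//.
  by rewrite (le_trans (l2norm_coef_block_le _ _))// (le_trans aM)// ler_norm.
rewrite -(@ler_pXn2r _ 2)// ?nnegrE ?l2norm_ge0 ?mulr_ge0//.
rewrite -l2norm_coef_block (@le_trans _ _ (\sum_(l < L.+1) B0 ^+ 2))//.
  by apply: ler_sum => l _; rewrite ler_pXn2r ?nnegrE ?l2norm_ge0.
rewrite sumr_const card_ord -[leLHS]mulr_natl exprMn ler_wpM2r ?sqr_ge0//.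
by rewrite -natrX ler_nat expnS expn1 leq_pmulr.
Qed.

Lemma Phi_continuous : continuous (fun x => Phi p eta L (complex_coords x)).
Proof.
have alg := @continuous_subalgebra R 'rV[R]_(dimL L + dimL L).
apply: (subalgebra_sum alg) => l; apply: (subalgebraM alg (subalgebra_cst alg _)).
apply: continuous_powR_comp; rewrite ?(ltW p1)//.
  by move=> x; exact: l2norm_ge0.
apply: l2norm_continuous => i.
have := complex_coords_continuous R (@tagnat.Rank _ (@block_size L) l i).
by congr (componentwise _ _); apply/funext => x; rewrite [in RHS]mxE.
Qed.

End Objective.

(** * The feasible set and its projection *)

Section Constraint.
Variables (Gamma : set (R * R * R)) (T : R * R * R -> R) (rho : R) (L : nat).
Hypotheses (mGamma : measurable Gamma) (Gamma_sphere : Gamma `<=` sphere R).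
Hypothesis Gamma_open : exists U : set (R * R * R),
  [/\ open U, U `&` sphere R !=set0 & U `&` sphere R `<=` Gamma].

Lemma gfun_complete_square (a : 'cV[R[i]]_(dimL L)) :
  let d := a - alpha_tilde Gamma T L in
  gfun Gamma T rho L a = gfun Gamma T rho L (alpha_tilde Gamma T L)
    + complex.Re ((map_mx Num.conj d^T *m Yhat Gamma L *m d) 0 0).
Proof.
set at_ := alpha_tilde _ _ _ => d.
have Yat : Yhat Gamma L *m at_ = ahat Gamma T L by rewrite mulKVmx// Yhat_unitmx.
have -> : a = at_ + d by rewrite addrC subrK.
clearbody d at_.
rewrite /gfun (hermitian_formD d (Yhat_hermitian mGamma Gamma_sphere (L := L)) Yat).
rewrite conj_mulmxDl.
have re (u v w t : R[i]) (e r : R) :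
    complex.Re (u + v + (w + Num.conj w)) - 2 * complex.Re (t + w) + e - r
    = complex.Re u - 2 * complex.Re t + e - r + complex.Re v.
  by case: u v w t => ? ? [? ?] [? ?] [? ?] /=; ring.
exact: re.
Qed.

Lemma gfun_alpha_tilde_le a :
  gfun Gamma T rho L (alpha_tilde Gamma T L) <= gfun Gamma T rho L a.
Proof. by rewrite [leRHS]gfun_complete_square lerDl Yhat_quad_ge0. Qed.

Lemma Fe_closed : closed (complex_coords (n := dimL L) @^-1` Fe Gamma T rho L).
Proof.
have alg := @continuous_subalgebra R 'rV[R]_(dimL L + dimL L).
apply: (@preimage_closed _ _ (fun x => gfun Gamma T rho L (complex_coords x))
  [set t | t <= 0]); last exact: closed_le.
move=> x _; apply: (_ : continuous _); rewrite {x}.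
have cc s : componentwise (fun f : 'rV[R]_(dimL L + dimL L) -> R => continuous f)
    (fun x => map_mx Num.conj (complex_coords x)^T 0 s).
  have := componentwise_conj alg (complex_coords_continuous R s).
  by congr (componentwise _ _); apply/funext => x; rewrite 2![in RHS]mxE.
have cst := componentwise_cst alg.
apply: (subalgebraD alg); last exact: (subalgebra_cst alg).
apply: (subalgebraD alg); last exact: (subalgebra_cst alg).
apply: (subalgebraD alg); last first.
  apply: (subalgebraN alg); apply: (subalgebraM alg (subalgebra_cst alg _)).
  apply: (componentwise_Re (componentwise_sum alg (index_enum _) xpredT
    (fun s => componentwiseM alg (cc s) (cst (ahat Gamma T L s 0))))) => x.
  by rewrite [in RHS]mxE.
apply: (componentwise_Re (componentwise_sum alg (index_enum _) xpredT (fun t =>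
  componentwiseM alg (componentwise_sum alg (index_enum _) xpredT
    (fun s => componentwiseM alg (cc s) (cst (Yhat Gamma L s t))))
    (complex_coords_continuous R t)))) => x.
rewrite [in RHS]mxE; congr (complex.Re _); apply: eq_bigr => t _.
by rewrite [in RHS]mxE.
Qed.

(** The distance to [a] is continuous and coercive and the feasible set is closed, so a nearest
    point exists and [xget] does not return its default. *)
Lemma metric_projP a : Fe Gamma T rho L !=set0 ->
  minimizer (fun y => l2norm (a - y)) (Fe Gamma T rho L)
    (metric_proj (Fe Gamma T rho L) a).
Proof.
move=> Fe0; apply: (@xgetPex _ 0 [set z | minimizer _ _ z]).
apply: exists_minimizer => //; last 2 first.
- exact: Fe_closed.
- move=> M; exists (M + l2norm a) => v vM.
  by rewrite -{1}(subrK a v) (le_trans (l2normD _ _))// lerD2r l2normB.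
have alg := @continuous_subalgebra R 'rV[R]_(dimL L + dimL L).
apply: l2norm_continuous => i.
have := componentwiseD alg (componentwise_cst alg (a i 0)) (componentwiseM alg
  (componentwise_cst alg (-1)) (complex_coords_continuous R i)).
by congr (componentwise _ _); apply/funext => x; rewrite mulN1r !mxE.
Qed.

End Constraint.
End Penalty.

Theorem theorem2 (R : realType) (p eta : R)
    (hp0 : 0 < p) (hp1 : p < 1) (heta : 1 < eta)
    (Gamma : set (R * R * R)) (hGamma : Gamma `<=` sphere R)
    (mGamma : measurable Gamma)
    (hGamma_open : exists U : set (R * R * R),
      [/\ open U, U `&` sphere R !=set0 & U `&` sphere R `<=` Gamma])
    (hGamma_compl : sphere R `\` Gamma !=set0)
    (T : R * R * R -> R) (hT : L2_sphere T)
    (rho : R) (hrho1 : energy T (sphere R `\` Gamma) < rho)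
    (hrho2 : rho < energy T (sphere R))
    (L : nat) (hFe : has_nonempty_interior (Fe Gamma T rho L))
    (eps : R) (heps : 0 < eps)
    (C : R) (hC : 0 < C)
    (herr : forall a : 'cV[R[i]]_(dimL L),
      dist_to a (Fe Gamma T rho L) <= C * pos_part (gfun Gamma T rho L a))
    (lambda : R) (hlambda0 : 0 < lambda)
    (hlambda : C * (eta ^+ L * L%:R `^ p) `^ (1 / p)
        * (eps * (L.+1)%:R `^ (p / 2 - 1)) `^ (- (1 / p))
        * Phi p eta L (alpha_tilde Gamma T L) <= lambda)
    (astar : 'cV[R[i]]_(dimL L))
    (hastar : minimizer (Flambda p eta Gamma T rho lambda L) setT astar) :
  eps_minimizer eps (Phi p eta L) (Fe Gamma T rho L)
    (metric_proj (Fe Gamma T rho L) astar).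
Proof.
have [z0 [r0 [r0_gt0 Fz0]]] := hFe.
have Fe_z0 : Fe Gamma T rho L z0 by apply: Fz0; rewrite subrr l2norm0.
have Fe0 : Fe Gamma T rho L !=set0 by exists z0.
have Fe_at : Fe Gamma T rho L (alpha_tilde Gamma T L).
  exact: le_trans (gfun_alpha_tilde_le T rho mGamma hGamma hGamma_open z0) Fe_z0.
have [y Fy] : exists y, minimizer (Phi p eta L) (Fe Gamma T rho L) y.
  apply: exists_minimizer; [|exact: Fe_closed|exact: Fe0|].
    exact: Phi_continuous.
  exact: Phi_coercive.
have projP := metric_projP (T := T) (rho := rho) (Gamma := Gamma) astar Fe0.
set z := metric_proj _ _ in projP *.
split; first by case: projP.
exists y => //; have [Fe_y y_min] := Fy.
have FlambdaE a : Fe Gamma T rho L a -> Flambda p eta Gamma T rho lambda L a = Phi p eta L a.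
  by move=> ga; rewrite /Flambda /pos_part (max_idPr ga) mulr0 addr0.
have [_ s_min] := hastar.
have [L0|L0] := posnP L.
  (* For [L = 0] the projection is even an exact minimizer. *)
  suff : Phi p eta L z <= Phi p eta L y by move=> /le_trans; apply; rewrite lerDl ltW.
  subst L; have PhiE a : Phi p eta 0 a = l2norm a `^ p.
    rewrite /Phi big_ord1 mul1r; congr (_ `^ p).
    apply/eqP; rewrite -(@eqrXn2 _ 2)// ?l2norm_ge0//.
    by rewrite -(l2norm_coef_block a) big_ord1.
  have [w quadE [d d0]] := dimL0_quad (Yhat Gamma 0).
  have d2 : 0 < l2norm d ^+ 2.
    rewrite exprn_gt0// lt_neqAle eq_sym l2norm_ge0 andbT.
    by apply: contra_neq d0; exact: l2norm_eq0.
  (* Definiteness of the Gram matrix, tested on the nonzero [d], makes the feasible set a ball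
     centred at [alpha_tilde]. *)
  have w0 : 0 < w.
    have := Yhat_quad_ge0 mGamma hGamma d; rewrite quadE pmulr_lge0// => w0.
    rewrite lt_neqAle w0 andbT eq_sym; apply/eqP => wE; move/eqP: d0; apply.
    by apply: (Yhat_quad_eq0 mGamma hGamma hGamma_open); rewrite quadE wE mul0r.
  rewrite !PhiE; apply: ge0_ler_powR; rewrite ?nnegrE ?l2norm_ge0 ?(ltW hp0)//.
  apply: (penalty_proj_ball hp0 w0 hlambda0 Fe_at _ _ projP Fe_y) => a.
    rewrite -quadE; exact: gfun_complete_square.
  rewrite -!PhiE; exact: (s_min a Logic.I).
set P := Phi p eta L in hlambda y_min FlambdaE *.
set gs := pos_part (gfun Gamma T rho L astar).
have gs0 : 0 <= gs by rewrite le_max lexx orbT.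
(* Two comparisons for the penalized minimizer: with [y] to bound its objective value, then with
   [alpha_tilde] to bound its violation. *)
have Ps_y : P astar <= P y.
  rewrite -(FlambdaE y Fe_y); apply: le_trans (s_min y Logic.I).
  by rewrite lerDl; apply: mulr_ge0; [exact: ltW|exact: gs0].
have lgs : lambda * gs <= P (alpha_tilde Gamma T L).
  rewrite -(FlambdaE _ Fe_at); apply: le_trans (s_min _ Logic.I).
  by rewrite lerDr; exact: Phi_ge0.
move: (P (alpha_tilde Gamma T L)) lgs hlambda => Pt lgs hlambda.
have dist_le : l2norm (astar - z) <= C * gs.
  exact: le_trans (dist_to_minimizer projP) (herr astar).
(* By subadditivity of the objective, only its value on the displacement to the projection
   matters. *)
suff Pd : P (z - astar) <= eps.
  apply: le_trans (lerD Ps_y Pd); rewrite -{1}(subrK astar z) addrC.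
  exact: Phi_triangle.
set B := eta ^+ L * L%:R `^ p in hlambda.
have eta0 : 0 <= eta by exact: le_trans ler01 (ltW heta).
have B0 : 0 <= B by rewrite mulr_ge0 ?powR_ge0 ?exprn_ge0.
set K := eps * L.+1%:R `^ (p / 2 - 1) in hlambda.
have K0 : 0 < K by rewrite mulr_gt0// powR_gt0// ltr0n.
have BdK := penalty_bound hp0 B0 K0 hC hlambda0 (l2norm_ge0 _) lgs dist_le hlambda.
rewrite /P; apply: le_trans (Phi_le_l2norm hp0 hp1 heta _ L0) _.
rewrite l2normB -/B mulrCA.
(* The powers of [L + 1] here and in [K] have opposite exponents, so [eps] alone remains. *)
apply: (@le_trans _ _ (L.+1%:R `^ (1 - p / 2) * K)).
  by rewrite ler_wpM2l ?powR_ge0.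
rewrite /K mulrCA -powRD; last by rewrite pnatr_eq0 implybT.
by rewrite addrA subrK subrr powRr0 mulr1.
Qed.
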